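(* For every complex number $q$ with $0<|q|<1$, \[ \sum_{k=1}^{\infty}q^{2k^2}[8k+1]\frac{(q;q^2)_{k}^2(q;q^2)_{2k}}{(q^2;q^2)_{2k}(q^6;q^6)_{k}^2}\sum_{i=1}^{k}\left\{\frac{q^{2i-1}}{[2i-1]^2}-\frac{q^{6i}}{[6i]^2}\right\} =\frac{(q^3;q^2)_{\infty}(q^3;q^6)_{\infty}}{(q^2;q^2)_{\infty}(q^6;q^6)_{\infty}}\sum_{j=1}^{\infty}(-1)^{j-1}\frac{q^{3j}}{[3j]^2}. \]
   Context: For complex $x,q$ with $|q|<1$: $(x;q)_\infty=\prod_{i\ge 0}(1-xq^i)$ and, for an integer $n\ge 0$, $(x;q)_n=\prod_{i=0}^{n-1}(1-xq^i)$. Multiple arguments mean products: $(x_1,\dots,x_r;q)_m=(x_1;q)_m\cdots(x_r;q)_m$. The $q$-integer is $[n]=1+q+\cdots+q^{n-1}=(1-q^n)/(1-q)$. *)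

(* Defs.v *)
From Stdlib Require Import Reals.
From Coquelicot Require Import Coquelicot.
Open Scope C_scope.

Fixpoint qpoch (x q : C) (n : nat) : C :=
  match n with
  | O => 1
  | S m => qpoch x q m * (1 - x * q ^ m)
  end.

Definition qpoch_inf_is (x q P : C) : Prop :=
  filterlim (fun n => qpoch x q n) eventually (locally P).

Definition qint (q : C) (n : nat) : C := (1 - q ^ n) / (1 - q).

Fixpoint sum1 (f : nat -> C) (k : nat) : C :=
  match k with
  | O => 0
  | S m => sum1 f m + f (S m)
  end.

Definition lhs_term (q : C) (k : nat) : C :=
  q ^ (2 * k * k) * qint q (8 * k + 1)
  * (qpoch q (q ^ 2) k * qpoch q (q ^ 2) k * qpoch q (q ^ 2) (2 * k))
  / (qpoch (q ^ 2) (q ^ 2) (2 * k) * qpoch (q ^ 6) (q ^ 6) k * qpoch (q ^ 6) (q ^ 6) k)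
  * sum1 (fun i => q ^ (2 * i - 1) / (qint q (2 * i - 1) * qint q (2 * i - 1))
                 - q ^ (6 * i) / (qint q (6 * i) * qint q (6 * i))) k.

Definition rhs_term (q : C) (j : nat) : C :=
  (- 1) ^ (j - 1) * q ^ (3 * j) / (qint q (3 * j) * qint q (3 * j)).

(* Main.v *)
Require Import Defs.
From Stdlib Require Import Reals Lra Lia.
From Coquelicot Require Import Coquelicot.
Open Scope C_scope.

(** Replace the two factors [(q;q^2)_k^2] and [(q^6;q^6)_k^2] of the summand by
    [(q x, q/x; q^2)_k] and [(q^6 x, q^6/x; q^6)_k].  By Gasper's cubic summation the sum over
    [k >= 0] is then a constant times [(q^3 x, q^3/x; q^6)_oo / (q^6 x, q^6/x; q^6)_oo].  Both
    sides depend on [x] through [u = x + 1/x - 2] only, and the theorem is the coefficient of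
    [u], which for each factor is its value at [u = 0] times a logarithmic derivative.

    Replacing [c] by [c q^(6N)] in Gasper's parameters gives a family whose suitably normalised
    terms form a WZ pair, so the sum does not depend on [N]; letting [N] tend to infinity leaves
    [sum_k q^(2k^2) (q x, q/x; q^2)_k / (q^2;q^2)_(2k)].  Expanding by the finite Jacobi triple
    product and applying Bailey's lemma turns this into [sum_r (-1)^r x^r q^(3r^2)], which is
    also the limit of the finite triple product in base [q^3]. *)

(** * Limits and finite sums of complex sequences *)

(** Stated through the real sequence of distances, so that real limit theorems (squeeze, sums,
    products, subsequences) transfer directly; [clim_filterlim] links it to the filter form of
    [qpoch_inf_is]. *)
Definition clim (u : nat -> C) (l : C) : Prop :=
  is_lim_seq (fun n => Cmod (u n - l)) 0%R.

Lemma clim_filterlim (u : nat -> C) (l : C) :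
  clim u l <-> filterlim u eventually (locally l).
Proof.
  split; intros H.
  - apply (filterlim_locally_ball_norm (K := C_AbsRing) (U := C_NormedModule)).
    intros eps. apply is_lim_seq_spec in H.
    destruct (H eps) as [N HN]. exists N. intros n Hn.
    specialize (HN n Hn). rewrite Rminus_0_r in HN.
    rewrite Rabs_pos_eq in HN by apply Cmod_ge_0. exact HN.
  - apply is_lim_seq_spec. intros eps.
    pose proof (proj1 (filterlim_locally_ball_norm (K := C_AbsRing)
      (U := C_NormedModule) u l) H eps) as [N HN].
    exists N. intros n Hn. rewrite Rminus_0_r.
    rewrite Rabs_pos_eq by apply Cmod_ge_0. exact (HN n Hn).
Qed.

Lemma clim_squeeze (u : nat -> C) (l : C) (e : nat -> R) :
  (forall n, Cmod (u n - l) <= e n)%R -> is_lim_seq e 0%R -> clim u l.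
Proof.
  intros Hu He. apply (is_lim_seq_le_le (fun _ => 0%R) _ e); auto.
  - intros n; split; [apply Cmod_ge_0 | apply Hu].
  - apply is_lim_seq_const.
Qed.

Lemma clim_ext_loc (u v : nat -> C) (l : C) (N : nat) :
  (forall n, (N <= n)%nat -> u n = v n) -> clim u l -> clim v l.
Proof.
  intros E. unfold clim. apply is_lim_seq_ext_loc. exists N.
  intros n Hn. now rewrite (E n Hn).
Qed.

Lemma clim_ext (u v : nat -> C) (l : C) :
  (forall n, u n = v n) -> clim u l -> clim v l.
Proof. intros E. apply (clim_ext_loc u v l 0). auto. Qed.

Lemma clim_const (l : C) : clim (fun _ => l) l.
Proof.
  apply (clim_squeeze _ _ (fun _ => 0%R)).
  - intros n. replace (l - l) with (RtoC 0) by ring. rewrite Cmod_0. lra.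
  - apply is_lim_seq_const.
Qed.

Lemma clim_unique (u : nat -> C) (l l' : C) : clim u l -> clim u l' -> l = l'.
Proof.
  intros H H'.
  assert (E : Cmod (l - l') = 0%R).
  { apply Rle_antisym; [| apply Cmod_ge_0].
    apply (is_lim_seq_le (fun _ => Cmod (l - l'))
      (fun n => Cmod (u n - l) + Cmod (u n - l'))%R (Cmod (l - l')) 0%R).
    - intros n. replace (l - l') with (- (u n - l) + (u n - l')) by ring.
      eapply Rle_trans; [apply Cmod_triangle|]. rewrite Cmod_opp. lra.
    - apply is_lim_seq_const.
    - replace (Finite 0) with (Rbar_plus 0 0)
        by (simpl; f_equal; ring).
      now apply is_lim_seq_plus'. }
  apply Cmod_eq_0 in E. replace l with (l' + (l - l')) by ring.
  rewrite E. ring.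
Qed.

Lemma clim_plus (u v : nat -> C) (l m : C) :
  clim u l -> clim v m -> clim (fun n => u n + v n) (l + m).
Proof.
  intros Hu Hv.
  apply (clim_squeeze _ _ (fun n => Cmod (u n - l) + Cmod (v n - m))%R).
  - intros n. replace (u n + v n - (l + m)) with ((u n - l) + (v n - m)) by ring.
    apply Cmod_triangle.
  - replace (Finite 0) with (Rbar_plus 0 0) by (simpl; f_equal; ring).
    now apply is_lim_seq_plus'.
Qed.

Lemma clim_mult (u v : nat -> C) (l m : C) :
  clim u l -> clim v m -> clim (fun n => u n * v n) (l * m).
Proof.
  intros Hu Hv.
  apply (clim_squeeze _ _ (fun n => Cmod (u n - l) * Cmod (v n - m)
     + (Cmod (u n - l) * Cmod m + Cmod l * Cmod (v n - m)))%R).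
  - intros n.
    replace (u n * v n - l * m)
      with ((u n - l) * (v n - m) + ((u n - l) * m + l * (v n - m))) by ring.
    eapply Rle_trans; [apply Cmod_triangle|]. rewrite Cmod_mult.
    apply Rplus_le_compat_l.
    eapply Rle_trans; [apply Cmod_triangle|]. rewrite !Cmod_mult. lra.
  - replace 0%R with (0 * 0 + (0 * Cmod m + Cmod l * 0))%R by ring.
    repeat apply is_lim_seq_plus'; apply is_lim_seq_mult';
      auto; apply is_lim_seq_const.
Qed.

Lemma clim_scal (c : C) (u : nat -> C) (l : C) :
  clim u l -> clim (fun n => c * u n) (c * l).
Proof. intros H. apply clim_mult; auto. apply clim_const. Qed.

(** The bound [d], valid at every index, gives [|1/u_n - 1/l| <= |u_n - l| / (d |l|)] from the
    start, without an eventual argument. *)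
Lemma clim_inv (u : nat -> C) (l : C) (d : R) :
  (0 < d)%R -> (forall n, d <= Cmod (u n))%R -> l <> 0 ->
  clim u l -> clim (fun n => / u n) (/ l).
Proof.
  intros Hd Hu Hl H.
  assert (Hl' : (0 < Cmod l)%R) by now apply Cmod_gt_0.
  assert (Hun : forall n, u n <> 0).
  { intros n. apply Cmod_gt_0. specialize (Hu n). lra. }
  apply (clim_squeeze _ _ (fun n => Cmod (u n - l) * (/ d * / Cmod l))%R).
  - intros n. replace (/ u n - / l) with (- (u n - l) * (/ u n * / l))
      by (field; auto).
    rewrite !Cmod_mult, Cmod_opp, !Cmod_inv; auto.
    apply Rmult_le_compat_l; [apply Cmod_ge_0|].
    apply Rmult_le_compat_r; [left; now apply Rinv_0_lt_compat|].
    apply Rinv_le_contravar; auto.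
  - replace 0%R with (0 * (/ d * / Cmod l))%R by ring.
    apply is_lim_seq_mult'; auto. apply is_lim_seq_const.
Qed.

Lemma clim_subseq (u : nat -> C) (l : C) (phi : nat -> nat) :
  (forall n, (n <= phi n)%nat) -> clim u l -> clim (fun n => u (phi n)) l.
Proof.
  intros Hphi H. apply (is_lim_seq_subseq (fun n => Cmod (u n - l)) _ phi); auto.
  intros P [N HN]. exists N. intros n Hn. apply HN. specialize (Hphi n). lia.
Qed.

Lemma clim_Cmod_ge (u : nat -> C) (l : C) (d : R) :
  (forall n, d <= Cmod (u n))%R -> clim u l -> (d <= Cmod l)%R.
Proof.
  intros Hd H.
  apply (is_lim_seq_le (fun _ => d) (fun n => Cmod (u n - l) + Cmod l)%R d (Cmod l)).
  - intros n. eapply Rle_trans; [apply Hd|].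
    replace (u n) with ((u n - l) + l) at 1 by ring. apply Cmod_triangle.
  - apply is_lim_seq_const.
  - replace (Finite (Cmod l)) with (Finite (0 + Cmod l)%R) by (f_equal; ring).
    apply is_lim_seq_plus'; auto. apply is_lim_seq_const.
Qed.

Lemma clim_Cmod_le (u : nat -> C) (l : C) (d : R) :
  (forall n, Cmod (u n) <= d)%R -> clim u l -> (Cmod l <= d)%R.
Proof.
  intros Hd H.
  apply (is_lim_seq_le (fun _ => Cmod l) (fun n => Cmod (u n - l) + d)%R (Cmod l) d).
  - intros n. replace l with (- (u n - l) + u n) at 1 by ring.
    eapply Rle_trans; [apply Cmod_triangle|]. rewrite Cmod_opp.
    specialize (Hd n). lra.
  - apply is_lim_seq_const.
  - replace (Finite d) with (Finite (0 + d)%R) by (f_equal; ring).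
    apply is_lim_seq_plus'; auto. apply is_lim_seq_const.
Qed.

(* The sum has [n] terms, unlike Coquelicot's [sum_n]. *)
Fixpoint csum (f : nat -> C) (n : nat) : C :=
  match n with
  | O => 0
  | S m => csum f m + f m
  end.

Lemma csum_ext (f g : nat -> C) (n : nat) :
  (forall k, (k < n)%nat -> f k = g k) -> csum f n = csum g n.
Proof.
  induction n as [|n IH]; intros H; simpl; auto.
  rewrite IH by (intros; apply H; lia). now rewrite (H n) by lia.
Qed.

Lemma csum_zero (f : nat -> C) (n : nat) :
  (forall k, (k < n)%nat -> f k = 0) -> csum f n = 0.
Proof.
  induction n as [|n IH]; intros H; simpl; auto.
  rewrite IH by (intros; apply H; lia). rewrite (H n) by lia. ring.
Qed.

Lemma csum_plus (f g : nat -> C) (n : nat) :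
  csum (fun k => f k + g k) n = csum f n + csum g n.
Proof. induction n as [|n IH]; simpl; [|rewrite IH]; ring. Qed.

Lemma csum_scal (c : C) (f : nat -> C) (n : nat) :
  csum (fun k => c * f k) n = c * csum f n.
Proof. induction n as [|n IH]; simpl; [|rewrite IH]; ring. Qed.

Lemma csum_telescope (g : nat -> C) (n : nat) :
  csum (fun k => g (S k) - g k) n = g n - g O.
Proof. induction n as [|n IH]; simpl; [|rewrite IH]; ring. Qed.

Lemma csum_switch (f : nat -> nat -> C) (n m : nat) :
  csum (fun i => csum (f i) m) n = csum (fun j => csum (fun i => f i j) n) m.
Proof.
  induction n as [|n IH]; simpl.
  - symmetry. now apply csum_zero.
  - now rewrite IH, csum_plus.
Qed.

Lemma csum_head (f : nat -> C) (n : nat) :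
  csum f (S n) = f O + csum (fun k => f (S k)) n.
Proof.
  induction n as [|n IH]; [simpl; ring|].
  change (csum f (S (S n))) with (csum f (S n) + f (S n)). rewrite IH.
  simpl. ring.
Qed.

Lemma csum_extend (f : nat -> C) (n m : nat) :
  (n <= m)%nat -> (forall k, (n <= k)%nat -> f k = 0) -> csum f m = csum f n.
Proof.
  intros H Hf. induction H as [|m H IH]; simpl; auto.
  rewrite IH, (Hf m H). ring.
Qed.

Lemma clim_csum (f : nat -> nat -> C) (g : nat -> C) (m : nat) :
  (forall k, clim (fun n => f n k) (g k)) ->
  clim (fun n => csum (f n) m) (csum g m).
Proof.
  intros H. induction m as [|m IH]; simpl.
  - apply clim_const.
  - now apply clim_plus.
Qed.

Lemma is_series_clim (f : nat -> C) (l : C) : clim (csum f) l -> is_series f l.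
Proof.
  intros H. change (filterlim (sum_n f) eventually (locally l)).
  apply clim_filterlim.
  apply (clim_ext (fun n => csum f (S n))).
  - induction n as [|n IH].
    + rewrite sum_O. simpl. ring.
    + rewrite sum_Sn, <- IH. reflexivity.
  - apply (clim_subseq (csum f) l S); auto.
Qed.

Lemma clim_series (f : nat -> C) (l : C) : is_series f l -> clim (csum f) l.
Proof.
  intros H.
  assert (H' : clim (sum_n f) l) by now apply clim_filterlim.
  apply (is_lim_seq_incr_1 (fun n => Cmod (csum f n - l))).
  revert H'. apply clim_ext.
  induction n as [|n IH].
  - rewrite sum_O. simpl. ring.
  - rewrite sum_Sn, IH. reflexivity.
Qed.

(** * Geometrically dominated series *)

Lemma geom_lim0 (K r : R) : (0 <= r < 1)%R -> is_lim_seq (fun n => K * r ^ n)%R 0%R.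
Proof.
  intros Hr. replace 0%R with (K * 0)%R by ring.
  apply is_lim_seq_mult'; [apply is_lim_seq_const|].
  apply is_lim_seq_geom. rewrite Rabs_pos_eq; lra.
Qed.

Lemma csum_geom_tail (f : nat -> C) (K r : R) (n m : nat) :
  (0 <= r < 1)%R -> (forall k, Cmod (f k) <= K * r ^ k)%R ->
  (Cmod (csum f (n + m) - csum f n) <= K * r ^ n / (1 - r))%R.
Proof.
  intros Hr Hf.
  assert (HK : (0 <= K)%R).
  { specialize (Hf O). simpl in Hf. pose proof (Cmod_ge_0 (f O)). lra. }
  (* Induction on [m] needs the exact partial geometric sum; the claimed bound is its relaxation. *)
  assert (H : (Cmod (csum f (n + m) - csum f n)
               <= K * r ^ n * (1 - r ^ m) / (1 - r))%R).
  { induction m as [|m IH].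
    - rewrite Nat.add_0_r. replace (csum f n - csum f n) with (RtoC 0) by ring.
      rewrite Cmod_0. simpl. unfold Rdiv. rewrite Rminus_diag. lra.
    - rewrite Nat.add_succ_r. simpl csum.
      replace (csum f (n + m) + f (n + m)%nat - csum f n)
        with ((csum f (n + m) - csum f n) + f (n + m)%nat) by ring.
      eapply Rle_trans; [apply Cmod_triangle|].
      eapply Rle_trans; [apply Rplus_le_compat; [exact IH | apply Hf]|].
      right. rewrite pow_add. simpl. field. lra. }
  eapply Rle_trans; [exact H|]. unfold Rdiv.
  apply Rmult_le_compat_r; [left; apply Rinv_0_lt_compat; lra|].
  assert (0 <= K * r ^ n)%R by (apply Rmult_le_pos; [|apply pow_le]; lra).
  assert (0 <= r ^ m)%R by (apply pow_le; lra). nra.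
Qed.

Lemma csum_geom_cvg (f : nat -> C) (K r : R) :
  (0 <= r < 1)%R -> (forall k, Cmod (f k) <= K * r ^ k)%R ->
  exists l, clim (csum f) l.
Proof.
  intros Hr Hf.
  destruct (ex_series_le (K := C_AbsRing) (V := C_CompleteNormedModule) f
              (fun k => K * r ^ k)%R) as [l Hl].
  - exact Hf.
  - apply (ex_series_scal_l (K := R_AbsRing) K (fun k => r ^ k)%R).
    apply ex_series_geom. rewrite Rabs_pos_eq; lra.
  - exists l. now apply clim_series.
Qed.

Lemma csum_geom_rest (f : nat -> C) (K r : R) (l : C) (n : nat) :
  (0 <= r < 1)%R -> (forall k, Cmod (f k) <= K * r ^ k)%R ->
  clim (csum f) l -> (Cmod (l - csum f n) <= K * r ^ n / (1 - r))%R.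
Proof.
  intros Hr Hf H.
  apply (clim_Cmod_le (fun m => csum f (n + m) - csum f n)).
  - intros m. now apply csum_geom_tail.
  - apply clim_plus; [|apply clim_const].
    apply (clim_subseq (csum f) l (fun m => (n + m)%nat)); auto. intros; lia.
Qed.

(** Dominated convergence for series. Both tails from [m] on are at most [K r^m / (1 - r)], below a
    quarter of [eps] for a suitable [m], and the first [m] terms converge one by one. *)
Lemma tannery (f : nat -> nat -> C) (g F : nat -> C) (G : C) (K r : R) :
  (0 <= r < 1)%R -> (forall n k, Cmod (f n k) <= K * r ^ k)%R ->
  (forall k, clim (fun n => f n k) (g k)) ->
  (forall n, clim (csum (f n)) (F n)) -> clim (csum g) G -> clim F G.
Proof.
  intros Hr Hf Hg HF HG.
  assert (Hgb : forall k, (Cmod (g k) <= K * r ^ k)%R).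
  { intros k. apply (clim_Cmod_le (fun n => f n k)); auto. }
  apply is_lim_seq_spec. intros eps.
  pose proof (geom_lim0 (K / (1 - r)) r Hr) as Hm.
  apply is_lim_seq_spec in Hm.
  assert (He : (0 < eps / 4)%R) by (destruct eps; simpl; lra).
  destruct (Hm (mkposreal _ He)) as [m Hm']. specialize (Hm' m (le_n m)).
  simpl in Hm'. rewrite Rminus_0_r in Hm'. apply Rabs_def2 in Hm'.
  pose proof (clim_csum f g m Hg) as Hc. apply is_lim_seq_spec in Hc.
  destruct (Hc (mkposreal _ He)) as [N HN]. exists N. intros n Hn.
  specialize (HN n Hn). simpl in HN.
  rewrite Rminus_0_r, Rabs_pos_eq in HN |- * by apply Cmod_ge_0.
  pose proof (csum_geom_rest (f n) K r (F n) m Hr (Hf n) (HF n)) as H1.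
  pose proof (csum_geom_rest g K r G m Hr Hgb HG) as H2.
  replace (F n - G) with ((F n - csum (f n) m)
     + ((csum (f n) m - csum g m) + - (G - csum g m))) by ring.
  eapply Rle_lt_trans; [apply Cmod_triangle|].
  eapply Rle_lt_trans; [apply Rplus_le_compat_l, Cmod_triangle|].
  rewrite Cmod_opp.
  replace (K * r ^ m / (1 - r))%R with (K / (1 - r) * r ^ m)%R in H1, H2
    by (field; lra).
  destruct eps as [e Hpe]. simpl in *. lra.
Qed.

Lemma clim_csum_finite (f : nat -> C) (n : nat) :
  (forall k, (n <= k)%nat -> f k = 0) -> clim (csum f) (csum f n).
Proof.
  intros H. apply (clim_ext_loc (fun _ => csum f n) _ _ n).
  - intros m Hm. symmetry. now apply csum_extend.
  - apply clim_const.
Qed.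

(** * Bounds for q-shifted factorials and Lambert sums *)

(** The real product [(r;r)_n], a yardstick for every [qpoch x b n] with [|x|, |b| <= r]. *)
Fixpoint euler_prod (r : R) (n : nat) : R :=
  match n with
  | O => 1
  | S m => euler_prod r m * (1 - r ^ S m)
  end.

Lemma pow_lt_1_S (r : R) (n : nat) : (0 <= r < 1)%R -> (0 <= r ^ S n < 1)%R.
Proof.
  intros Hr. split; [apply pow_le; lra|].
  simpl. assert (0 <= r ^ n <= 1)%R.
  { split; [apply pow_le; lra|]. rewrite <- (pow1 n). apply pow_incr. lra. }
  nra.
Qed.

Lemma euler_prod_pos (r : R) (n : nat) : (0 <= r < 1)%R -> (0 < euler_prod r n)%R.
Proof.
  intros Hr. induction n as [|n IH]; cbn [euler_prod]; [lra|].
  apply Rmult_lt_0_compat; auto. pose proof (pow_lt_1_S r n Hr). lra.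
Qed.

(* Weierstrass: prod (1 - x_i) >= 1 - sum x_i, applied beyond the index where the geometric tail drops below 1/2. *)
Lemma euler_prod_lower (r : R) :
  (0 <= r < 1)%R -> exists d, (0 < d <= 1)%R /\ forall n, (d <= euler_prod r n)%R.
Proof.
  intros Hr.
  pose proof (geom_lim0 (/ (1 - r)) r Hr) as Hm. apply is_lim_seq_spec in Hm.
  assert (He : (0 < / 2)%R) by lra.
  destruct (Hm (mkposreal _ He)) as [m Hm']. specialize (Hm' m (le_n m)).
  simpl in Hm'. rewrite Rminus_0_r in Hm'. apply Rabs_def2 in Hm'.
  assert (Hdec : forall n j, (euler_prod r (n + j) <= euler_prod r n)%R).
  { intros n j. induction j as [|j IH]; [rewrite Nat.add_0_r; lra|].
    rewrite Nat.add_succ_r. cbn [euler_prod].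
    pose proof (pow_lt_1_S r (n + j) Hr). pose proof (euler_prod_pos r (n + j) Hr). nra. }
  assert (Hw : forall j, (euler_prod r m * (1 - r ^ S m * (1 - r ^ j) / (1 - r))
                          <= euler_prod r (m + j))%R).
  { induction j as [|j IH].
    - rewrite Nat.add_0_r. simpl. right. field. lra.
    - rewrite Nat.add_succ_r. cbn [euler_prod].
      pose proof (pow_lt_1_S r (m + j) Hr) as Hp.
      pose proof (Hdec m j) as Hd. pose proof (euler_prod_pos r (m + j) Hr).
      replace (1 - r ^ S m * (1 - r ^ S j) / (1 - r))%R
        with (1 - r ^ S m * (1 - r ^ j) / (1 - r) - r ^ S (m + j))%R
        by (simpl; rewrite pow_add; field; lra).
      pose proof (euler_prod_pos r m Hr). nra. }
  pose proof (euler_prod_pos r m Hr) as Hpm.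
  exists (euler_prod r m / 2)%R. split.
  { split; [lra|]. pose proof (Hdec O m) as H. simpl in H. lra. }
  intros n. destruct (Nat.le_ge_cases m n) as [H|H].
  - replace n with (m + (n - m))%nat by lia. eapply Rle_trans; [|apply Hw].
    unfold Rdiv. apply Rmult_le_compat_l; [lra|].
    assert (0 <= r ^ (n - m))%R by (apply pow_le; lra).
    assert (0 <= r ^ m)%R by (apply pow_le; lra).
    assert (Hi : (0 < / (1 - r))%R) by (apply Rinv_0_lt_compat; lra).
    assert (Hx : (r ^ S m * (1 - r ^ (n - m)) * / (1 - r) <= / (1 - r) * r ^ m)%R).
    { rewrite (Rmult_comm (/ (1 - r))). apply Rmult_le_compat_r; [lra|].
      simpl. assert (0 <= r * r ^ m)%R by nra.
      assert (r * r ^ m <= r ^ m)%R by nra. nra. }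
    lra.
  - pose proof (Hdec n (m - n)%nat) as Hd.
    replace (n + (m - n))%nat with m in Hd by lia. lra.
Qed.

Lemma Cmod_mul_pow_le (x b : C) (r : R) (n : nat) :
  (Cmod x <= r)%R -> (Cmod b <= r)%R -> (Cmod (x * b ^ n) <= r ^ S n)%R.
Proof.
  intros Hx Hb. rewrite Cmod_mult, Cmod_pow. simpl.
  apply Rmult_le_compat; auto using Cmod_ge_0, pow_le.
  apply pow_incr. split; auto using Cmod_ge_0.
Qed.

Lemma one_minus_Cmod (z : C) : (1 - Cmod z <= Cmod (1 - z) <= 1 + Cmod z)%R.
Proof.
  split.
  - pose proof (Cmod_triangle (1 - z) z) as H.
    replace (1 - z + z) with (RtoC 1) in H by ring. rewrite Cmod_1 in H. lra.
  - unfold Cminus. eapply Rle_trans; [apply Cmod_triangle|].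
    rewrite Cmod_opp, Cmod_1. lra.
Qed.

Lemma qpoch_lower (x b : C) (r : R) (n : nat) :
  (0 <= r < 1)%R -> (Cmod x <= r)%R -> (Cmod b <= r)%R ->
  (euler_prod r n <= Cmod (qpoch x b n))%R.
Proof.
  intros Hr Hx Hb. induction n as [|n IH]; cbn [qpoch euler_prod].
  - rewrite Cmod_1. lra.
  - rewrite Cmod_mult. pose proof (pow_lt_1_S r n Hr).
    apply Rmult_le_compat; auto.
    + left. now apply euler_prod_pos.
    + lra.
    + pose proof (one_minus_Cmod (x * b ^ n)).
      pose proof (Cmod_mul_pow_le x b r n Hx Hb). lra.
Qed.

(** Factor by factor, [1 + t <= 1 / (1 - t)] with [t = r^(n+1)], so the reciprocal of the lower
    bound is an upper bound. *)
Lemma qpoch_upper (x b : C) (r : R) (n : nat) :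
  (0 <= r < 1)%R -> (Cmod x <= r)%R -> (Cmod b <= r)%R ->
  (Cmod (qpoch x b n) <= / euler_prod r n)%R.
Proof.
  intros Hr Hx Hb. induction n as [|n IH]; cbn [qpoch euler_prod].
  - rewrite Cmod_1, Rinv_1. lra.
  - rewrite Cmod_mult, Rinv_mult. pose proof (pow_lt_1_S r n Hr) as Hp.
    apply Rmult_le_compat; auto using Cmod_ge_0.
    pose proof (one_minus_Cmod (x * b ^ n)).
    pose proof (Cmod_mul_pow_le x b r n Hx Hb).
    apply Rle_trans with (1 + r ^ S n)%R; [lra|].
    apply Rmult_le_reg_r with (1 - r ^ S n)%R; [lra|].
    rewrite Rinv_l by lra. nra.
Qed.

(** A single [d] serves all arguments, bases and lengths; this uniformity later yields majorants
    independent of the limit parameter. *)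
Lemma qpoch_bounds (r : R) :
  (0 <= r < 1)%R -> exists d, (0 < d <= 1)%R /\
  forall x b n, (Cmod x <= r)%R -> (Cmod b <= r)%R ->
    (d <= Cmod (qpoch x b n) <= / d)%R.
Proof.
  intros Hr. destruct (euler_prod_lower r Hr) as [d [Hd H]].
  exists d. split; auto. intros x b n Hx Hb. split.
  - eapply Rle_trans; [apply H|]. now apply qpoch_lower.
  - eapply Rle_trans; [now apply (qpoch_upper x b r)|].
    apply Rinv_le_contravar; [lra | apply H].
Qed.

Lemma qpoch_neq_0 (x b : C) (n : nat) :
  (Cmod x < 1)%R -> (Cmod b < 1)%R -> qpoch x b n <> 0.
Proof.
  intros Hx Hb. set (r := Rmax (Cmod x) (Cmod b)).
  assert (Hr : (0 <= r < 1)%R).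
  { split; [|now apply Rmax_lub_lt].
    eapply Rle_trans; [apply Cmod_ge_0 | apply Rmax_l]. }
  apply Cmod_gt_0. eapply Rlt_le_trans; [now apply (euler_prod_pos r n)|].
  apply qpoch_lower; [exact Hr | apply Rmax_l | apply Rmax_r].
Qed.

(** Consecutive partial products differ by [x b^k] times a bounded factor, so the product converges
    as a telescoping series; the uniform lower bound survives in the limit and makes it nonzero. *)
Lemma qpoch_inf_ex (x b : C) :
  (Cmod x < 1)%R -> (Cmod b < 1)%R -> exists P : C, P <> 0 /\ clim (qpoch x b) P.
Proof.
  intros Hx Hb. set (r := Rmax (Cmod x) (Cmod b)).
  assert (Hr : (0 <= r < 1)%R).
  { split; [|now apply Rmax_lub_lt].
    eapply Rle_trans; [apply Cmod_ge_0 | apply Rmax_l]. }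
  assert (Hxr : (Cmod x <= r)%R) by apply Rmax_l.
  assert (Hbr : (Cmod b <= r)%R) by apply Rmax_r.
  destruct (qpoch_bounds r Hr) as [d [Hd H]].
  destruct (csum_geom_cvg (fun k => qpoch x b (S k) - qpoch x b k) (/ d) r Hr)
    as [l Hl].
  - intros k. simpl.
    replace (qpoch x b k * (1 - x * b ^ k) - qpoch x b k)
      with (- (qpoch x b k * (x * b ^ k))) by ring.
    rewrite Cmod_opp, Cmod_mult.
    apply Rmult_le_compat; auto using Cmod_ge_0; [now apply H|].
    eapply Rle_trans; [now apply (Cmod_mul_pow_le x b r)|].
    pose proof (pow_le r k). simpl. nra.
  - assert (HP : clim (qpoch x b) (l + 1)).
    { apply (clim_ext (fun n => csum (fun k => qpoch x b (S k) - qpoch x b k) n + 1)).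
      - intros n. rewrite csum_telescope. simpl. ring.
      - apply clim_plus; auto. apply clim_const. }
    exists (Cplus l 1). split; auto.
    apply Cmod_gt_0. apply Rlt_le_trans with d; [lra|].
    apply (clim_Cmod_ge (qpoch x b)); auto. intros n. now apply H.
Qed.

Lemma one_minus_neq_0 (z : C) : (Cmod z < 1)%R -> 1 - z <> 0.
Proof.
  intros H. apply Cmod_gt_0. pose proof (one_minus_Cmod z). lra.
Qed.

Lemma Cmod_pow_lt_1 (q : C) (n : nat) :
  (Cmod q < 1)%R -> (0 < n)%nat -> (Cmod (q ^ n) < 1)%R.
Proof.
  intros H Hn. rewrite Cmod_pow. destruct n; [lia|].
  apply pow_lt_1_S. split; auto. apply Cmod_ge_0.
Qed.

Lemma Cmod_pow_le (q : C) (n : nat) :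
  (Cmod q < 1)%R -> (0 < n)%nat -> (Cmod (q ^ n) <= Cmod q)%R.
Proof.
  intros H Hn. destruct n; [lia|]. rewrite Cpow_S, Cmod_mult.
  assert (Cmod (q ^ n) <= 1)%R.
  { rewrite Cmod_pow, <- (pow1 n). apply pow_incr.
    split; [apply Cmod_ge_0 | lra]. }
  pose proof (Cmod_ge_0 q). nra.
Qed.

(* Minus the derivative at [u = 0] of the logarithm of the product over [i < n] of
   [(1 - x b^i)^2 - x b^i u]. *)
Definition lambert (x b : C) (n : nat) : C :=
  csum (fun i => x * b ^ i / (1 - x * b ^ i) ^ 2) n.

Lemma lambert_term_le (x b : C) (r : R) (n : nat) :
  (0 <= r < 1)%R -> (Cmod x <= r)%R -> (Cmod b <= r)%R ->
  (Cmod (x * b ^ n / (1 - x * b ^ n) ^ 2) <= / (1 - r) ^ 2 * r ^ n)%R.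
Proof.
  intros Hr Hx Hb.
  pose proof (Cmod_mul_pow_le x b r n Hx Hb) as H.
  pose proof (pow_lt_1_S r n Hr) as Hp.
  assert (Hn : (0 <= r ^ n <= 1)%R).
  { split; [apply pow_le; lra|]. rewrite <- (pow1 n). apply pow_incr. lra. }
  pose proof (one_minus_Cmod (x * b ^ n)) as H1.
  assert (Hrn : (r ^ S n <= r)%R) by (simpl; nra).
  rewrite Cmod_div, Cmod_pow.
  - unfold Rdiv. rewrite Rmult_comm.
    apply Rmult_le_compat; auto using Cmod_ge_0.
    + left. apply Rinv_0_lt_compat, pow_lt. lra.
    + apply Rinv_le_contravar; [apply pow_lt; lra|]. apply pow_incr. lra.
    + simpl in H. nra.
  - apply Cpow_nz, one_minus_neq_0. lra.
Qed.

Lemma lambert_cvg (x b : C) :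
  (Cmod x < 1)%R -> (Cmod b < 1)%R -> exists l, clim (lambert x b) l.
Proof.
  intros Hx Hb. set (r := Rmax (Cmod x) (Cmod b)).
  assert (Hr : (0 <= r < 1)%R).
  { split; [|now apply Rmax_lub_lt].
    eapply Rle_trans; [apply Cmod_ge_0 | apply Rmax_l]. }
  apply (csum_geom_cvg _ (/ (1 - r) ^ 2) r Hr).
  intros k. apply lambert_term_le; [exact Hr | apply Rmax_l | apply Rmax_r].
Qed.

Lemma lambert_bound (r : R) :
  (0 <= r < 1)%R -> exists M, (0 <= M)%R /\
  forall x b n, (Cmod x <= r)%R -> (Cmod b <= r)%R -> (Cmod (lambert x b n) <= M)%R.
Proof.
  intros Hr. exists (/ (1 - r) ^ 2 * r ^ 0 / (1 - r))%R. split.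
  - apply Rmult_le_pos; [apply Rmult_le_pos|];
      [left; apply Rinv_0_lt_compat, pow_lt; lra | simpl; lra
      |left; apply Rinv_0_lt_compat; lra].
  - intros x b n Hx Hb.
    pose proof (csum_geom_tail (fun i => x * b ^ i / (1 - x * b ^ i) ^ 2)
      (/ (1 - r) ^ 2) r 0 n Hr) as H.
    replace (lambert x b n) with (csum (fun i => x * b ^ i / (1 - x * b ^ i) ^ 2) (0 + n)
      - csum (fun i => x * b ^ i / (1 - x * b ^ i) ^ 2) 0)
      by (unfold lambert; simpl; ring).
    apply H. intros k. now apply lambert_term_le.
Qed.

(** * Finite Jacobi triple product *)

Lemma Cpow_S_r (c : C) (n : nat) : c ^ S n = c ^ n * c.
Proof. rewrite Cpow_S. ring. Qed.

Ltac cpow_eq :=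
  rewrite <- ?Cpow_mult_r;
  repeat first [rewrite <- Cpow_add_r | rewrite <- Cpow_S_r | rewrite <- Cpow_S];
  f_equal; nia.

Ltac neq0 :=
  cbv beta; first [assumption | match goal with
    N : ?a <> _ |- ?b <> _ => replace b with a by ring; exact N end].

Ltac cfield := field; repeat split; neq0.

Lemma Cmult_cancel_l (c x y : C) : c <> 0 -> c * x = c * y -> x = y.
Proof.
  intros Hc H. replace x with (/ c * (c * x)) by (field; auto).
  rewrite H. field. auto.
Qed.

(* [rqp p n k] is [1 / (p;p)_(n-k)], with the convention that it vanishes for [k > n]. *)
Definition rqp (p : C) (n k : nat) : C :=
  if Nat.leb k n then / qpoch p p (n - k) else 0.

Lemma rqp_gt (p : C) (n k : nat) : (n < k)%nat -> rqp p n k = 0.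
Proof. intros H. unfold rqp. now rewrite (proj2 (Nat.leb_gt k n) H). Qed.

Lemma rqp_le (p : C) (n k : nat) : (k <= n)%nat -> rqp p n k = / qpoch p p (n - k).
Proof. intros H. unfold rqp. now rewrite (proj2 (Nat.leb_le k n) H). Qed.

Lemma qpoch_self_S (p : C) (n : nat) : qpoch p p (S n) = qpoch p p n * (1 - p ^ S n).
Proof. reflexivity. Qed.

Lemma one_minus_pow_neq_0 (p : C) (n : nat) : (Cmod p < 1)%R -> 1 - p ^ S n <> 0.
Proof. intros H. apply one_minus_neq_0, Cmod_pow_lt_1; auto. lia. Qed.

(** For [k > n] truncated subtraction turns the factor into [1 - p^0 = 0], in agreement with the
    zero convention of [rqp]. *)
Lemma rqp_S_l (p : C) (n k : nat) :
  (Cmod p < 1)%R -> rqp p (S n) k * (1 - p ^ (S n - k)) = rqp p n k.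
Proof.
  intros Hp. destruct (Nat.lt_total n k) as [H|H].
  - rewrite (rqp_gt p n k H). replace (S n - k)%nat with O by lia. simpl. ring.
  - rewrite !rqp_le by lia. replace (S n - k)%nat with (S (n - k)) by lia.
    rewrite qpoch_self_S. pose proof (one_minus_pow_neq_0 p (n - k) Hp).
    pose proof (qpoch_neq_0 p p (n - k) Hp Hp). cfield.
Qed.

Lemma rqp_S_r (p : C) (n k : nat) :
  (Cmod p < 1)%R -> rqp p n (S k) = rqp p n k * (1 - p ^ (n - k)).
Proof.
  intros Hp.
  destruct (Nat.le_gt_cases n k) as [H|H].
  - rewrite (rqp_gt p n (S k)) by lia.
    replace (n - k)%nat with O by lia. simpl. ring.
  - rewrite !rqp_le by lia. replace (n - k)%nat with (S (n - S k)) by lia.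
    rewrite qpoch_self_S. pose proof (one_minus_pow_neq_0 p (n - S k) Hp).
    pose proof (qpoch_neq_0 p p (n - S k) Hp Hp). cfield.
Qed.

(* The finite Jacobi triple product is
   [prod_(i<=k) (1 - x q^(2i-1)) (1 - q^(2i-1)/x) / (q^2;q^2)_(2k) = sum_r x^r jtp_coef q k r]
   over [-k <= r <= k]. *)
Definition jtp_coef (q : C) (k r : nat) : C :=
  (- 1) ^ r * q ^ (r * r) * rqp (q ^ 2) k r / qpoch (q ^ 2) (q ^ 2) (k + r).

(** The coefficients are even in [r], so the sum over [-k <= r <= k] folds onto [0 <= r <= k]; [w r]
    stands for [x^r + x^(-r)], and [w 0] for 1. *)
Definition jtp_sum (q : C) (w : nat -> C) (k : nat) : C :=
  csum (fun r => w r * jtp_coef q k r) (S k).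

Lemma jtp_coef_gt (q : C) (k r : nat) : (k < r)%nat -> jtp_coef q k r = 0.
Proof.
  intros H. unfold jtp_coef. rewrite rqp_gt by auto. unfold Cdiv. ring.
Qed.

(** Coefficient of [x^(r+1)] after multiplying the [k]-th product by [(1 - x q^(2k+1)) (1 -
    q^(2k+1)/x) = 1 + q^(4k+2) - q^(2k+1) (x + 1/x)]; the factors on the left update
    [(q^2;q^2)_(2k)]. *)
Lemma jtp_coef_rec (q : C) (k r : nat) :
  (0 < Cmod q)%R -> (Cmod q < 1)%R ->
  (1 - q ^ (4 * k + 2)) * (1 - q ^ (4 * k + 4)) * jtp_coef q (S k) (S r)
  = (1 + q ^ (4 * k + 2)) * jtp_coef q k (S r)
    - q ^ (2 * k + 1) * (jtp_coef q k r + jtp_coef q k (S (S r))).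
Proof.
  intros Hq0 Hq.
  destruct (Nat.lt_total k r) as [H|H].
  { rewrite !jtp_coef_gt by lia. ring. }
  assert (Hrk : (r <= k)%nat) by lia. clear H.
  assert (q0 : q <> 0) by now apply Cmod_gt_0.
  assert (Hp : (Cmod (q ^ 2) < 1)%R) by (apply Cmod_pow_lt_1; auto).
  pose proof (one_minus_pow_neq_0 (q ^ 2) (k + r) Hp) as N1.
  pose proof (one_minus_pow_neq_0 (q ^ 2) (S (k + r)) Hp) as N2.
  pose proof (qpoch_neq_0 (q ^ 2) (q ^ 2) (k + r) Hp Hp) as N3.
  (* All neighbours are expressed through [rqp (q^2) (S k) (S r)]. The factor [q^2] in [E3] avoids
     the exponent [k - S r], which truncates when [k = r]. *)
  assert (E1 : rqp (q ^ 2) k r = rqp (q ^ 2) (S k) (S r)).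
  { rewrite !rqp_le by lia. reflexivity. }
  pose proof (rqp_S_l (q ^ 2) k (S r) Hp) as E2.
  assert (E3 : rqp (q ^ 2) k (S (S r)) * q ^ 2
     = rqp (q ^ 2) k (S r) * (q ^ 2 - (q ^ 2) ^ (S k - S r))).
  { rewrite (rqp_S_r (q ^ 2) k (S r) Hp).
    destruct (Nat.eq_dec k r) as [->|Hne].
    - rewrite (rqp_gt (q ^ 2) r (S r)) by lia. ring.
    - replace ((q ^ 2) ^ (S k - S r)) with (q ^ 2 * (q ^ 2) ^ (k - S r)) by cpow_eq.
      ring. }
  assert (E3' : rqp (q ^ 2) k (S (S r))
     = rqp (q ^ 2) k (S r) * (q ^ 2 - (q ^ 2) ^ (S k - S r)) / q ^ 2).
  { rewrite <- E3. cfield. }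
  unfold jtp_coef.
  rewrite E3', <- E2, E1.
  replace (S k + S r)%nat with (S (S (k + r))) by lia.
  replace (k + S (S r))%nat with (S (S (k + r))) by lia.
  replace (k + S r)%nat with (S (k + r)) by lia.
  rewrite !qpoch_self_S.
  replace (q ^ (S r * S r)) with (q ^ (r * r) * (q ^ r) ^ 2 * q) by cpow_eq.
  replace (q ^ (S (S r) * S (S r))) with (q ^ (r * r) * (q ^ r) ^ 4 * q ^ 4) by cpow_eq.
  set (y := (q ^ 2) ^ (S k - S r)).
  set (a := q ^ r).
  assert (Ek : q ^ (2 * k + 1) = y * a ^ 2 * q) by (unfold y, a; cpow_eq).
  assert (Ek2 : q ^ (4 * k + 2) = y ^ 2 * a ^ 4 * q ^ 2) by (unfold y, a; cpow_eq).
  assert (Ek4 : q ^ (4 * k + 4) = y ^ 2 * a ^ 4 * q ^ 4) by (unfold y, a; cpow_eq).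
  assert (Er1 : (q ^ 2) ^ S (k + r) = y * a ^ 4 * q ^ 2) by (unfold y, a; cpow_eq).
  assert (Er2 : (q ^ 2) ^ S (S (k + r)) = y * a ^ 4 * q ^ 4) by (unfold y, a; cpow_eq).
  rewrite Er1 in N1. rewrite Er2 in N2.
  rewrite Ek, Ek2, Ek4, Er1, Er2, !(Cpow_S (- 1)).
  clearbody y a. cfield.
Qed.

(** At [r = 0] the two neighbours, those of [x] and [1/x], have equal coefficients, whence the
    factor 2. *)
Lemma jtp_coef_rec_0 (q : C) (k : nat) :
  (0 < Cmod q)%R -> (Cmod q < 1)%R ->
  (1 - q ^ (4 * k + 2)) * (1 - q ^ (4 * k + 4)) * jtp_coef q (S k) 0
  = (1 + q ^ (4 * k + 2)) * jtp_coef q k 0 - q ^ (2 * k + 1) * (2 * jtp_coef q k 1).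
Proof.
  intros Hq0 Hq.
  assert (q0 : q <> 0) by now apply Cmod_gt_0.
  assert (Hp : (Cmod (q ^ 2) < 1)%R) by (apply Cmod_pow_lt_1; auto).
  pose proof (one_minus_pow_neq_0 (q ^ 2) k Hp) as N1.
  pose proof (qpoch_neq_0 (q ^ 2) (q ^ 2) k Hp Hp) as N3.
  pose proof (rqp_S_l (q ^ 2) k 0 Hp) as E1.
  pose proof (rqp_S_r (q ^ 2) k 0 Hp) as E2.
  unfold jtp_coef. rewrite E2, <- E1.
  rewrite (Nat.add_1_r k), !Nat.add_0_r, qpoch_self_S.
  rewrite !Nat.sub_0_r.
  set (y := q ^ k).
  assert (Ek : q ^ (2 * k + 1) = y ^ 2 * q) by (unfold y; cpow_eq).
  assert (Ek2 : q ^ (4 * k + 2) = y ^ 4 * q ^ 2) by (unfold y; cpow_eq).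
  assert (Ek4 : q ^ (4 * k + 4) = y ^ 4 * q ^ 4) by (unfold y; cpow_eq).
  assert (Er1 : (q ^ 2) ^ S k = y ^ 2 * q ^ 2) by (unfold y; cpow_eq).
  assert (Er2 : (q ^ 2) ^ k = y ^ 2) by (unfold y; cpow_eq).
  rewrite Er1 in N1.
  rewrite Ek, Ek2, Ek4, Er1, Er2. simpl (1 * 1)%nat. simpl (0 * 0)%nat.
  rewrite (Cpow_S (- 1)). clearbody y. cfield.
Qed.

(* Transpose, on even weights, of the operator [w r |-> w (r-1) + w (r+1)]. *)
Definition even_shift (w : nat -> C) (r : nat) : C :=
  match r with
  | O => w 1%nat
  | S O => 2 * w O + w 2%nat
  | S (S r) => w (S r) + w (S (S (S r)))
  end.

(** Summation by parts, moving the neighbour sum from the coefficients to the weights; the boundary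
    terms vanish for [c = jtp_coef q n], which is zero beyond [n]. *)
Lemma even_shift_sum (w c : nat -> C) (n : nat) :
  w O * (2 * c 1%nat)
    + csum (fun r => w (S r) * (c r + c (S (S r)))) (S n)
  = csum (fun r => even_shift w r * c r) (S (S n))
    + w (S n) * c (S (S n)) - w (S (S n)) * c (S n).
Proof.
  induction n as [|n IH]; [simpl; ring|].
  change (csum (fun r => w (S r) * (c r + c (S (S r)))) (S (S n)))
    with (csum (fun r => w (S r) * (c r + c (S (S r)))) (S n)
       + w (S (S n)) * (c (S n) + c (S (S (S n))))).
  rewrite Cplus_assoc, IH.
  change (csum (fun r => even_shift w r * c r) (S (S (S n))))
    with (csum (fun r => even_shift w r * c r) (S (S n))
       + even_shift w (S (S n)) * c (S (S n))).
  simpl even_shift. ring.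
Qed.

Lemma jtp_sum_rec (q : C) (w : nat -> C) (k : nat) :
  (0 < Cmod q)%R -> (Cmod q < 1)%R ->
  (1 - q ^ (4 * k + 2)) * (1 - q ^ (4 * k + 4)) * jtp_sum q w (S k)
  = (1 + q ^ (4 * k + 2)) * jtp_sum q w k - q ^ (2 * k + 1) * jtp_sum q (even_shift w) k.
Proof.
  intros Hq0 Hq.
  assert (E : forall v, jtp_sum q v k = csum (fun r => v r * jtp_coef q k r) (S (S k))).
  { intros v. symmetry. apply csum_extend; [lia|].
    intros r Hr. rewrite jtp_coef_gt by lia. ring. }
  rewrite !E. unfold jtp_sum. rewrite <- csum_scal.
  pose proof (even_shift_sum w (jtp_coef q k) k) as H.
  rewrite (jtp_coef_gt q k (S (S k))), (jtp_coef_gt q k (S k)) in H by lia.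
  replace (csum (fun r => even_shift w r * jtp_coef q k r) (S (S k)))
    with (w O * (2 * jtp_coef q k 1)
     + csum (fun r => w (S r) * (jtp_coef q k r + jtp_coef q k (S (S r)))) (S k))
    by (rewrite H; ring).
  rewrite !(csum_head _ (S k)).
  rewrite (csum_ext _ (fun r => (1 + q ^ (4 * k + 2)) * (w (S r) * jtp_coef q k (S r))
    + (- q ^ (2 * k + 1)) * (w (S r) * (jtp_coef q k r + jtp_coef q k (S (S r)))))).
  - rewrite csum_plus, !csum_scal.
    replace ((1 - q ^ (4 * k + 2)) * (1 - q ^ (4 * k + 4)) * (w O * jtp_coef q (S k) 0))
      with (w O * ((1 - q ^ (4 * k + 2)) * (1 - q ^ (4 * k + 4)) * jtp_coef q (S k) 0))
      by ring.
    rewrite (jtp_coef_rec_0 q k Hq0 Hq). ring.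
  - intros r _.
    replace ((1 - q ^ (4 * k + 2)) * (1 - q ^ (4 * k + 4)) * (w (S r) * jtp_coef q (S k) (S r)))
      with (w (S r) * ((1 - q ^ (4 * k + 2)) * (1 - q ^ (4 * k + 4)) * jtp_coef q (S k) (S r)))
      by ring.
    rewrite (jtp_coef_rec q k r Hq0 Hq). ring.
Qed.

(* With [x + 1/x = 2 + u] one has [x^r + x^-r = 2 + r^2 u + O(u^2)]: [w_one] and
   [w_sq] are the weights giving the value and the first derivative at [u = 0]. *)
Definition w_one (r : nat) : C := match r with O => 1 | S _ => 2 end.
Definition w_sq (r : nat) : C := RtoC (INR r) ^ 2.

(** [even_shift] acts as multiplication by [x + 1/x = 2 + u]; this lemma and the next are its orders
    0 and 1 in [u], the extra [w_one] in the next being [u] times the value. *)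
Lemma even_shift_one (r : nat) : even_shift w_one r = 2 * w_one r.
Proof. destruct r as [|[|r]]; simpl; ring. Qed.

Lemma even_shift_sq (r : nat) : even_shift w_sq r = 2 * w_sq r + w_one r.
Proof.
  destruct r as [|[|r]]; unfold even_shift, w_sq, w_one;
    rewrite ?S_INR, ?RtoC_plus; simpl INR; try rewrite !RtoC_plus; ring.
Qed.

(** The triple product at [x = 1]: the multiplier of the recurrence becomes [1 + q^(4k+2) - 2
    q^(2k+1) = (1 - q^(2k+1))^2]. *)
Lemma jtp_sum_one (q : C) (k : nat) :
  (0 < Cmod q)%R -> (Cmod q < 1)%R ->
  jtp_sum q w_one k = qpoch q (q ^ 2) k ^ 2 / qpoch (q ^ 2) (q ^ 2) (2 * k).
Proof.
  intros Hq0 Hq.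
  assert (Hp : (Cmod (q ^ 2) < 1)%R) by (apply Cmod_pow_lt_1; auto).
  induction k as [|k IH].
  - unfold jtp_sum, jtp_coef, rqp. simpl. field. 
  - pose proof (jtp_sum_rec q w_one k Hq0 Hq) as H.
    assert (E : jtp_sum q (even_shift w_one) k = 2 * jtp_sum q w_one k).
    { unfold jtp_sum. rewrite <- csum_scal. apply csum_ext. intros r _.
      rewrite even_shift_one. ring. }
    rewrite E, IH in H.
    pose proof (one_minus_pow_neq_0 (q ^ 2) (2 * k) Hp) as N1.
    pose proof (one_minus_pow_neq_0 (q ^ 2) (S (2 * k)) Hp) as N2.
    pose proof (qpoch_neq_0 (q ^ 2) (q ^ 2) (2 * k) Hp Hp) as N3.
    replace (2 * S k)%nat with (S (S (2 * k))) by lia.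
    rewrite !qpoch_self_S. cbn [qpoch].
    set (y := q ^ k).
    assert (Ek : q ^ (2 * k + 1) = y ^ 2 * q) by (unfold y; cpow_eq).
    assert (Ek2 : q ^ (4 * k + 2) = y ^ 4 * q ^ 2) by (unfold y; cpow_eq).
    assert (Ek4 : q ^ (4 * k + 4) = y ^ 4 * q ^ 4) by (unfold y; cpow_eq).
    assert (Er1 : (q ^ 2) ^ S (2 * k) = y ^ 4 * q ^ 2) by (unfold y; cpow_eq).
    assert (Er2 : (q ^ 2) ^ S (S (2 * k)) = y ^ 4 * q ^ 4) by (unfold y; cpow_eq).
    assert (Er3 : (q ^ 2) ^ k = y ^ 2) by (unfold y; cpow_eq).
    rewrite Er1 in N1. rewrite Er2 in N2. rewrite Er1, Er2, Er3.
    rewrite Ek, Ek2, Ek4 in H. clearbody y.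
    apply (Cmult_cancel_l ((1 - y ^ 4 * q ^ 2) * (1 - y ^ 4 * q ^ 4))).
    + apply Cmult_neq_0; auto.
    + rewrite H. cfield.
Qed.

(** Derivative at [u = 0]: the recurrence keeps the multiplier [(1 - q^(2k+1))^2] and gains the
    source [- q^(2k+1)] times the value; their quotient is one more Lambert term. *)
Lemma jtp_sum_sq (q : C) (k : nat) :
  (0 < Cmod q)%R -> (Cmod q < 1)%R ->
  jtp_sum q w_sq k
  = - (qpoch q (q ^ 2) k ^ 2 / qpoch (q ^ 2) (q ^ 2) (2 * k) * lambert q (q ^ 2) k).
Proof.
  intros Hq0 Hq.
  assert (Hp : (Cmod (q ^ 2) < 1)%R) by (apply Cmod_pow_lt_1; auto).
  induction k as [|k IH].
  - unfold jtp_sum, jtp_coef, rqp, w_sq, lambert. simpl. field.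
  - pose proof (jtp_sum_rec q w_sq k Hq0 Hq) as H.
    assert (E : jtp_sum q (even_shift w_sq) k = 2 * jtp_sum q w_sq k + jtp_sum q w_one k).
    { unfold jtp_sum. rewrite <- csum_scal, <- csum_plus. apply csum_ext. intros r _.
      rewrite even_shift_sq. ring. }
    rewrite E, IH, (jtp_sum_one q k Hq0 Hq) in H.
    pose proof (one_minus_pow_neq_0 (q ^ 2) (2 * k) Hp) as N1.
    pose proof (one_minus_pow_neq_0 (q ^ 2) (S (2 * k)) Hp) as N2.
    pose proof (qpoch_neq_0 (q ^ 2) (q ^ 2) (2 * k) Hp Hp) as N3.
    pose proof (one_minus_pow_neq_0 q (2 * k) Hq) as N4.
    replace (2 * S k)%nat with (S (S (2 * k))) by lia.
    change (lambert q (q ^ 2) (S k)) with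
      (lambert q (q ^ 2) k + q * (q ^ 2) ^ k / (1 - q * (q ^ 2) ^ k) ^ 2).
    rewrite !qpoch_self_S. cbn [qpoch].
    set (y := q ^ k) in *.
    assert (Ek : q ^ (2 * k + 1) = y ^ 2 * q) by (unfold y; cpow_eq).
    assert (Ek' : q ^ S (2 * k) = q * y ^ 2) by (unfold y; cpow_eq).
    assert (Ek2 : q ^ (4 * k + 2) = y ^ 4 * q ^ 2) by (unfold y; cpow_eq).
    assert (Ek4 : q ^ (4 * k + 4) = y ^ 4 * q ^ 4) by (unfold y; cpow_eq).
    assert (Er1 : (q ^ 2) ^ S (2 * k) = y ^ 4 * q ^ 2) by (unfold y; cpow_eq).
    assert (Er2 : (q ^ 2) ^ S (S (2 * k)) = y ^ 4 * q ^ 4) by (unfold y; cpow_eq).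
    assert (Er3 : (q ^ 2) ^ k = y ^ 2) by (unfold y; cpow_eq).
    rewrite Er1 in N1. rewrite Er2 in N2. rewrite Ek' in N4. rewrite Er1, Er2, Er3.
    rewrite Ek, Ek2, Ek4 in H. clearbody y.
    apply (Cmult_cancel_l ((1 - y ^ 4 * q ^ 2) * (1 - y ^ 4 * q ^ 4))).
    + apply Cmult_neq_0; auto.
    + rewrite H. cfield.
Qed.

(** * Bailey's lemma *)

Definition bailey_term (p : C) (r n k : nat) : C :=
  p ^ (k * k) * rqp p n k * rqp p k r / qpoch p p (k + r).

(* Companion of [bailey_term (S n)] in the telescoping proof of the q-Vandermonde sum
   below; truncated subtraction makes it vanish for [k <= r]. *)
Definition bailey_cert (p : C) (r n k : nat) : C :=
  - (p ^ (S n - k) * (1 - p ^ (k - r)) * (1 - p ^ (k + r)) * bailey_term p r (S n) k).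

Lemma bailey_term_lt (p : C) (r n k : nat) : (k < r)%nat -> bailey_term p r n k = 0.
Proof.
  intros H. unfold bailey_term. rewrite (rqp_gt p k r H). unfold Cdiv. ring.
Qed.

Lemma bailey_term_gt (p : C) (r n k : nat) : (n < k)%nat -> bailey_term p r n k = 0.
Proof.
  intros H. unfold bailey_term. rewrite (rqp_gt p n k H). unfold Cdiv. ring.
Qed.

(** A WZ certificate for the step from [n] to [n + 1]: generically a rational identity in [p],
    [p^(n-k)], [p^(k-r)] and [p^(k+r)]. The cases [k < r] and [k = n + 1], where terms vanish and
    exponents truncate, are separate. *)
Lemma bailey_term_telescope (p : C) (r n k : nat) :
  (0 < Cmod p)%R -> (Cmod p < 1)%R -> (r <= n)%nat -> (k <= S n)%nat ->
  (1 - p ^ (S n - r)) * (1 - p ^ (S n + r)) * bailey_term p r (S n) k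
  - bailey_term p r n k = bailey_cert p r n (S k) - bailey_cert p r n k.
Proof.
  intros Hp0 Hp Hr Hk. unfold bailey_cert.
  destruct (Nat.lt_ge_cases k r) as [H|H].
  { rewrite !(bailey_term_lt p r _ k) by auto.
    replace (S k - r)%nat with O by lia. simpl (p ^ 0). ring. }
  destruct (Nat.eq_dec k (S n)) as [->|Hne].
  { rewrite !(bailey_term_gt p r n), (bailey_term_gt p r (S n) (S (S n))) by lia.
    rewrite Nat.sub_diag. simpl (p ^ 0). ring. }
  assert (p0 : p <> 0) by now apply Cmod_gt_0.
  unfold bailey_term.
  rewrite (rqp_S_r p (S n) k Hp), <- (rqp_S_l p n k Hp), <- (rqp_S_l p k r Hp).
  change (S k + r)%nat with (S (k + r)). rewrite qpoch_self_S.
  pose proof (one_minus_pow_neq_0 p (k + r) Hp) as N1.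
  pose proof (qpoch_neq_0 p p (k + r) Hp Hp) as N2.
  set (y := p ^ (S n - S k)). set (a := p ^ (k - r)). set (b := p ^ (k + r)).
  assert (E1 : p ^ (S n - r) = p * y * a) by (unfold y, a; cpow_eq).
  assert (E2 : p ^ (S n + r) = p * y * b) by (unfold y, b; cpow_eq).
  assert (E3 : p ^ (S n - k) = p * y) by (unfold y; cpow_eq).
  assert (E4 : p ^ (S k - r) = p * a) by (unfold a; cpow_eq).
  assert (E5 : p ^ S (k + r) = p * b) by (unfold b; cpow_eq).
  assert (E6 : p ^ (S k * S k) = p ^ (k * k) * p * (a * b)).
  { unfold a, b. rewrite <- Cpow_add_r. cpow_eq. }
  rewrite E5 in N1. rewrite E1, E2, E3, E4, E5, E6.
  clearbody y a b. cfield.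
Qed.

(* A form of the q-Vandermonde sum. *)
Lemma bailey_sum (p : C) (r n : nat) :
  (0 < Cmod p)%R -> (Cmod p < 1)%R ->
  csum (bailey_term p r n) (S n) = p ^ (r * r) * rqp p n r / qpoch p p (n + r).
Proof.
  intros Hp0 Hp. destruct (Nat.lt_ge_cases n r) as [H|H].
  { rewrite csum_zero.
    - rewrite rqp_gt by auto. unfold Cdiv. ring.
    - intros k Hk. apply bailey_term_lt. lia. }
  induction H as [|n H IH].
  - simpl. rewrite csum_zero by (intros; now apply bailey_term_lt).
    unfold bailey_term. rewrite rqp_le, Nat.sub_diag by auto.
    pose proof (qpoch_neq_0 p p (r + r) Hp Hp). simpl. field. auto.
  - apply (Cmult_cancel_l ((1 - p ^ (S n - r)) * (1 - p ^ (S n + r)))).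
    + apply Cmult_neq_0; apply one_minus_neq_0, Cmod_pow_lt_1; auto; lia.
    + rewrite <- csum_scal.
      rewrite (csum_ext _ (fun k => bailey_term p r n k
        + (bailey_cert p r n (S k) - bailey_cert p r n k))).
      2:{ intros k Hk. rewrite <- (bailey_term_telescope p r n k) by (auto; lia). ring. }
      rewrite csum_plus, csum_telescope.
      rewrite (csum_extend (bailey_term p r n) (S n) (S (S n))); [|lia|].
      2:{ intros k Hk. apply bailey_term_gt. lia. }
      (* Both ends of the telescoped sum vanish: at [k = n + 2] through [bailey_term], at [k = 0]
         because [0 - r] truncates to 0. *)
      rewrite IH. unfold bailey_cert.
      rewrite (bailey_term_gt p r (S n) (S (S n))) by lia.
      replace (0 - r)%nat with O by lia.
      rewrite <- (rqp_S_l p n r Hp).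
      replace (S n + r)%nat with (S (n + r)) by lia. rewrite qpoch_self_S.
      pose proof (one_minus_pow_neq_0 p (n + r) Hp) as N1.
      pose proof (qpoch_neq_0 p p (n + r) Hp Hp) as N2.
      simpl (p ^ 0). cfield.
Qed.

(** Exchange the two sums, then sum over [k] by [bailey_sum] in base [q^2]; its factor [q^(2r^2)]
    raises the exponent [r^2] of the triple product to [3r^2]. *)
Lemma bailey_transform (q : C) (w : nat -> C) (n : nat) :
  (0 < Cmod q)%R -> (Cmod q < 1)%R ->
  csum (fun k => q ^ (2 * k * k) * jtp_sum q w k * rqp (q ^ 2) n k) (S n)
  = csum (fun r => w r * (- 1) ^ r * q ^ (3 * r * r)
                   * (rqp (q ^ 2) n r / qpoch (q ^ 2) (q ^ 2) (n + r))) (S n).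
Proof.
  intros Hq0 Hq.
  assert (Hp : (Cmod (q ^ 2) < 1)%R) by (apply Cmod_pow_lt_1; auto).
  assert (Hp0 : (0 < Cmod (q ^ 2))%R).
  { rewrite Cmod_pow. now apply pow_lt. }
  rewrite (csum_ext _ (fun k => csum (fun r =>
     w r * (- 1) ^ r * q ^ (r * r) * bailey_term (q ^ 2) r n k) (S n))).
  - rewrite csum_switch. apply csum_ext. intros r _.
    rewrite csum_scal, bailey_sum by auto.
    replace (q ^ (3 * r * r)) with (q ^ (r * r) * (q ^ 2) ^ (r * r)) by cpow_eq.
    unfold Cdiv. ring.
  - intros k Hk. unfold jtp_sum.
    rewrite <- (csum_extend (fun r => w r * jtp_coef q k r) (S k) (S n)); [|lia|].
    2:{ intros r Hr. rewrite jtp_coef_gt by lia. ring. }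
    rewrite Cmult_comm, Cmult_assoc, <- csum_scal. apply csum_ext. intros r _.
    unfold jtp_coef, bailey_term.
    replace (q ^ (2 * k * k)) with ((q ^ 2) ^ (k * k)) by cpow_eq.
    unfold Cdiv. ring.
Qed.

(** * Passage to the limit in Bailey's lemma *)

Lemma rqp_bound (p : C) (d : R) (n k : nat) :
  (0 < d)%R -> (forall n, d <= Cmod (qpoch p p n))%R -> (Cmod (rqp p n k) <= / d)%R.
Proof.
  intros Hd H. unfold rqp. destruct (Nat.leb k n).
  - rewrite Cmod_inv.
    + apply Rinv_le_contravar; auto.
    + apply Cmod_gt_0. eapply Rlt_le_trans; [exact Hd | apply H].
  - rewrite Cmod_0. left. now apply Rinv_0_lt_compat.
Qed.

Lemma clim_shift_sub (u : nat -> C) (l : C) (k : nat) :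
  clim u l -> clim (fun n => u (n - k)%nat) l.
Proof.
  intros H. apply is_lim_seq_spec. intros eps. apply is_lim_seq_spec in H.
  destruct (H eps) as [N HN]. exists (N + k)%nat. intros n Hn. apply HN. lia.
Qed.

Lemma rqp_lim (p P : C) (d : R) (k : nat) :
  (0 < d)%R -> (forall n, d <= Cmod (qpoch p p n))%R -> P <> 0 ->
  clim (qpoch p p) P -> clim (fun n => rqp p n k) (/ P).
Proof.
  intros Hd H HP Hl. apply (clim_ext_loc (fun n => / qpoch p p (n - k)) _ _ k).
  - intros n Hn. now rewrite rqp_le.
  - apply (clim_inv _ _ d); auto. now apply (clim_shift_sub (qpoch p p)).
Qed.

Lemma INR_mul_pow_le (r : R) (n : nat) :
  (0 <= r < 1)%R -> (INR n * r ^ n <= / (1 - r))%R.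
Proof.
  intros Hr. assert (Hi : (0 < / (1 - r))%R) by (apply Rinv_0_lt_compat; lra).
  (* [n r^n] is at most [1 + r + ... + r^(n-1)], since each of these [n] powers is at least
     [r^n]. *)
  assert (H : (INR n * r ^ n <= (1 - r ^ n) * / (1 - r))%R).
  { induction n as [|n IH]; [simpl; lra|]. rewrite S_INR.
    assert (0 <= r ^ n)%R by (apply pow_le; lra).
    assert (r ^ n <= 1)%R.
    { rewrite <- (pow1 n). apply pow_incr. lra. }
    replace ((1 - r ^ S n) * / (1 - r))%R with (r ^ n + (1 - r ^ n) * / (1 - r))%R
      by (simpl; field; lra).
    pose proof (pos_INR n). simpl.
    assert (INR n * (r * r ^ n) <= INR n * r ^ n)%R by (apply Rmult_le_compat_l; nra).
    nra. }
  eapply Rle_trans; [exact H|].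
  assert (0 <= r ^ n)%R by (apply pow_le; lra). nra.
Qed.

Lemma pow_le_compat_exp (r : R) (m n : nat) :
  (0 <= r <= 1)%R -> (n <= m)%nat -> (r ^ m <= r ^ n)%R.
Proof.
  intros Hr H. replace m with (n + (m - n))%nat by lia. rewrite pow_add.
  assert (0 <= r ^ n)%R by (apply pow_le; lra).
  assert (r ^ (m - n) <= 1)%R.
  { rewrite <- (pow1 (m - n)). apply pow_incr. lra. }
  nra.
Qed.

(** Of the exponent [3r^2], one [r^2] absorbs the quadratic growth of the weight and the remaining
    [2r^2] still exceeds [r]. *)
Lemma weight_bound (w : nat -> C) (q : C) :
  (Cmod q < 1)%R -> (forall r, Cmod (w r) <= INR (r * r) + 2)%R ->
  exists K, (0 <= K)%R /\
  forall r, (Cmod (w r * (- 1) ^ r * q ^ (3 * r * r)) <= K * Cmod q ^ r)%R.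
Proof.
  intros Hq Hw. set (t := Cmod q).
  assert (Ht : (0 <= t < 1)%R) by (split; [apply Cmod_ge_0 | exact Hq]).
  assert (Hi : (0 < / (1 - t))%R) by (apply Rinv_0_lt_compat; lra).
  exists (/ (1 - t) + 2)%R. split; [lra|]. intros r.
  rewrite !Cmod_mult, !Cmod_pow, Cmod_R, Rabs_m1, pow1, Rmult_1_r. fold t.
  replace (3 * r * r)%nat with (r * r + 2 * (r * r))%nat by lia. rewrite pow_add.
  assert (A1 : (t ^ (2 * (r * r)) <= t ^ r)%R).
  { apply pow_le_compat_exp; [lra | nia]. }
  assert (A2 : (0 <= t ^ (2 * (r * r)))%R) by (apply pow_le; lra).
  assert (A3 : (0 <= t ^ (r * r) <= 1)%R).
  { split; [apply pow_le; lra|]. rewrite <- (pow1 (r * r)). apply pow_incr. lra. }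
  pose proof (INR_mul_pow_le t (r * r) Ht) as A4.
  rewrite <- Rmult_assoc. apply Rmult_le_compat; auto.
  - apply Rmult_le_pos; [apply Cmod_ge_0 | lra].
  - apply Rle_trans with ((INR (r * r) + 2) * t ^ (r * r))%R.
    + apply Rmult_le_compat_r; [lra | apply Hw].
    + lra.
Qed.

(** The base [p] is kept apart from [q] because the lemma serves twice: with [p = q^2] for Bailey's
    sum and with [p = q^6] for the triple product in base [q^3]. *)
Lemma jtp_limit (p P W : C) (w : nat -> C) (q : C) :
  (Cmod q < 1)%R -> (Cmod p < 1)%R -> (forall r, Cmod (w r) <= INR (r * r) + 2)%R ->
  clim (qpoch p p) P -> P <> 0 ->
  clim (csum (fun r => w r * (- 1) ^ r * q ^ (3 * r * r))) W ->
  clim (fun n => csum (fun r => w r * (- 1) ^ r * q ^ (3 * r * r)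
                   * (rqp p n r / qpoch p p (n + r))) (S n)) (W * (/ P * / P)).
Proof.
  intros Hq Hp Hw HP P0 HW.
  assert (Hr : (0 <= Cmod p < 1)%R) by (split; [apply Cmod_ge_0 | exact Hp]).
  destruct (qpoch_bounds (Cmod p) Hr) as [d [Hd Hb]].
  assert (Hb' : forall n, (d <= Cmod (qpoch p p n))%R).
  { intros n. apply Hb; lra. }
  destruct (weight_bound w q Hq Hw) as [K [HK Hwb]].
  assert (Hdi : (0 < / d)%R) by (apply Rinv_0_lt_compat; lra).
  assert (Ht : (0 <= Cmod q < 1)%R) by (split; [apply Cmod_ge_0 | exact Hq]).
  apply (tannery (fun n r => w r * (- 1) ^ r * q ^ (3 * r * r)
      * (rqp p n r / qpoch p p (n + r)))
    (fun r => (w r * (- 1) ^ r * q ^ (3 * r * r)) * (/ P * / P)) _ _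
    (K * (/ d * / d))%R (Cmod q)); auto.
  - intros n r. rewrite Cmod_mult.
    replace (K * (/ d * / d) * Cmod q ^ r)%R
      with (K * Cmod q ^ r * (/ d * / d))%R by ring.
    apply Rmult_le_compat; auto using Cmod_ge_0.
    unfold Cdiv. rewrite Cmod_mult.
    apply Rmult_le_compat; auto using Cmod_ge_0.
    + apply rqp_bound; auto. lra.
    + rewrite Cmod_inv by (apply qpoch_neq_0; auto).
      apply Rinv_le_contravar; [lra | apply Hb'].
  - intros r. apply clim_scal, clim_mult.
    + apply (rqp_lim p P d); auto. lra.
    + apply (clim_inv _ _ d); auto; [lra|].
      apply (clim_subseq (qpoch p p) P (fun n => (n + r)%nat)); auto. intros; lia.
  - intros n. apply clim_csum_finite. intros r Hn.
    rewrite rqp_gt by lia. unfold Cdiv. ring.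
  - apply (clim_ext (fun n => (/ P * / P) * csum (fun r => w r * (- 1) ^ r * q ^ (3 * r * r)) n)).
    + intros n. rewrite <- csum_scal. apply csum_ext. intros; apply Cmult_comm.
    + rewrite (Cmult_comm W). now apply clim_scal.
Qed.

(* The q^2-series of the [jtp_sum q w k] and the limit of the [jtp_sum (q^3) w n] are the
   same theta-type series [sum_r w_r (-1)^r q^(3 r^2)] up to infinite products. *)
Lemma jtp_series (q P3 P4 : C) (w : nat -> C) (K : R) :
  (0 < Cmod q)%R -> (Cmod q < 1)%R -> (forall r, Cmod (w r) <= INR (r * r) + 2)%R ->
  (forall k, Cmod (jtp_sum q w k) <= K)%R ->
  clim (qpoch (q ^ 2) (q ^ 2)) P3 -> P3 <> 0 ->
  clim (qpoch (q ^ 6) (q ^ 6)) P4 -> P4 <> 0 ->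
  exists L : C, clim (jtp_sum (q ^ 3) w) L /\
    clim (csum (fun k => q ^ (2 * k * k) * jtp_sum q w k)) (L * (P4 * P4) / P3).
Proof.
  intros Hq0 Hq Hw HK HP3 N3 HP4 N4.
  assert (Ht : (0 <= Cmod q < 1)%R) by (split; [apply Cmod_ge_0 | exact Hq]).
  assert (HK0 : (0 <= K)%R).
  { eapply Rle_trans; [apply Cmod_ge_0 | apply (HK O)]. }
  assert (Hp : (Cmod (q ^ 2) < 1)%R) by (apply Cmod_pow_lt_1; auto).
  assert (Hp6 : (Cmod (q ^ 6) < 1)%R) by (apply Cmod_pow_lt_1; auto; lia).
  destruct (weight_bound w q Hq Hw) as [Kw [HKw Hwb]].
  destruct (csum_geom_cvg _ Kw (Cmod q) Ht Hwb) as [W HW].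
  assert (Hterm : forall k, (Cmod (q ^ (2 * k * k) * jtp_sum q w k) <= K * Cmod q ^ k)%R).
  { intros k. rewrite Cmod_mult, Cmod_pow, Rmult_comm.
    apply Rmult_le_compat; auto using Cmod_ge_0.
    - apply pow_le, Cmod_ge_0.
    - apply pow_le_compat_exp; [lra | nia]. }
  destruct (csum_geom_cvg _ K (Cmod q) Ht Hterm) as [B HB].
  exists (W * (/ P4 * / P4)). split.
  - apply (clim_ext (fun n => csum (fun r => w r * (- 1) ^ r * q ^ (3 * r * r)
                   * (rqp (q ^ 6) n r / qpoch (q ^ 6) (q ^ 6) (n + r))) (S n))).
    + intros n. apply csum_ext. intros r _. unfold jtp_coef.
      replace ((q ^ 3) ^ 2) with (q ^ 6) by cpow_eq.
      replace ((q ^ 3) ^ (r * r)) with (q ^ (3 * r * r)) by cpow_eq.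
      unfold Cdiv. ring.
    + now apply jtp_limit.
  (* The two sides of [bailey_transform] have the same limit, which is [B / P3] on one side and
     [W / P3^2] on the other. *)
  - assert (E : B * / P3 = W * (/ P3 * / P3)).
    { apply (clim_unique (fun n => csum (fun r => w r * (- 1) ^ r * q ^ (3 * r * r)
                   * (rqp (q ^ 2) n r / qpoch (q ^ 2) (q ^ 2) (n + r))) (S n)));
        [|now apply jtp_limit].
      apply (clim_ext (fun n => csum (fun k =>
         q ^ (2 * k * k) * jtp_sum q w k * rqp (q ^ 2) n k) (S n))).
      { intros n. now apply bailey_transform. }
      destruct (qpoch_bounds (Cmod (q ^ 2))) as [d [Hd Hb]].
      { split; [apply Cmod_ge_0 | exact Hp]. }
      assert (Hb' : forall n, (d <= Cmod (qpoch (q ^ 2) (q ^ 2) n))%R).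
      { intros n. apply Hb; lra. }
      apply (tannery (fun n k => q ^ (2 * k * k) * jtp_sum q w k * rqp (q ^ 2) n k)
        (fun k => q ^ (2 * k * k) * jtp_sum q w k * / P3) _ _ (K * / d)%R (Cmod q)); auto.
      - intros n k. rewrite Cmod_mult.
        replace (K * / d * Cmod q ^ k)%R with (K * Cmod q ^ k * / d)%R by ring.
        apply Rmult_le_compat; auto using Cmod_ge_0. apply rqp_bound; auto. lra.
      - intros k. apply clim_scal. apply (rqp_lim _ _ d); auto. lra.
      - intros n. apply clim_csum_finite. intros k Hk. rewrite rqp_gt by lia. ring.
      - apply (clim_ext (fun n => / P3 * csum (fun k => q ^ (2 * k * k) * jtp_sum q w k) n)).
        + intros n. rewrite <- csum_scal. apply csum_ext. intros; apply Cmult_comm.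
        + rewrite (Cmult_comm B). now apply clim_scal. }
    replace (W * (/ P4 * / P4) * (P4 * P4) / P3) with B; auto.
    replace B with (B * / P3 * P3) by (field; auto). rewrite E. field. auto.
Qed.

(** * The WZ pair *)

(* [cubic_term q N k] is [1 - q] times the coefficient of [u] in
   [q^(2k^2) [8k+1+6N] (q;q^2)_(3N+2k) (q x, q/x; q^2)_k
    / ((q^2;q^2)_(2k) (q^3;q^6)_N (q^6 x, q^6/x; q^6)_(N+k))],
   and [cubic_cert] is its WZ companion; the last factor of the kernel is the logarithmic
   derivative, the others are values at [u = 0]. *)
Definition cubic_kernel (q : C) (m N k : nat) : C :=
  qpoch q (q ^ 2) (3 * N + 2 * k)
  * (qpoch q (q ^ 2) k * qpoch q (q ^ 2) k * / qpoch (q ^ 2) (q ^ 2) (2 * k))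
  * / qpoch (q ^ 3) (q ^ 6) m
  * (/ qpoch (q ^ 6) (q ^ 6) (N + k) * / qpoch (q ^ 6) (q ^ 6) (N + k))
  * (lambert (q ^ 6) (q ^ 6) (N + k) - lambert q (q ^ 2) k).

Definition cubic_term (q : C) (N k : nat) : C :=
  q ^ (2 * k * k) * (1 - q ^ (8 * k + 1 + 6 * N)) * cubic_kernel q N N k.

Definition cubic_cert (q : C) (N k : nat) : C :=
  q ^ (2 * k * k) * (q ^ (6 * N + 1) * (1 - q ^ (4 * k)) * (q ^ 2 - q ^ (4 * k)))
  * cubic_kernel q (S N) N k.

Lemma qpoch_S (x b : C) (n : nat) : qpoch x b (S n) = qpoch x b n * (1 - x * b ^ n).
Proof. reflexivity. Qed.

Lemma lambert_S (x b : C) (n : nat) :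
  lambert x b (S n) = lambert x b n + x * b ^ n / (1 - x * b ^ n) ^ 2.
Proof. reflexivity. Qed.

(** In the certificate, [1 - q^(4k)] and [q^2 - q^(4k)] cancel the last two factors of
    [(q^2;q^2)_(2k)] up to a power of [q], and [(q^3;q^6)] runs one step ahead of [N]. Once shifted
    factors are split off, a rational identity in [q], [q^k] and [q^(6N)] remains, with products and
    Lambert sums as free variables. *)
Lemma cubic_telescope (q : C) (N k : nat) :
  (Cmod q < 1)%R ->
  cubic_term q N k - cubic_term q (S N) k = cubic_cert q N (S k) - cubic_cert q N k.
Proof.
  intros Hq. unfold cubic_term, cubic_cert, cubic_kernel.
  assert (Hp2 : (Cmod (q ^ 2) < 1)%R) by (apply Cmod_pow_lt_1; auto; lia).
  assert (Hp3 : (Cmod (q ^ 3) < 1)%R) by (apply Cmod_pow_lt_1; auto; lia).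
  assert (Hp6 : (Cmod (q ^ 6) < 1)%R) by (apply Cmod_pow_lt_1; auto; lia).
  replace (3 * S N + 2 * k)%nat with (S (S (S (3 * N + 2 * k)))) by lia.
  replace (3 * N + 2 * S k)%nat with (S (S (3 * N + 2 * k))) by lia.
  replace (2 * S k)%nat with (S (S (2 * k))) by lia.
  replace (S N + k)%nat with (S (N + k)) by lia.
  replace (N + S k)%nat with (S (N + k)) by lia.
  rewrite !lambert_S, !qpoch_S.
  set (a := q ^ k). set (M := (q ^ N) ^ 6).
  assert (E1 : q * (q ^ 2) ^ (3 * N + 2 * k) = q * (M * a ^ 4)) by (unfold M, a; cpow_eq).
  assert (E2 : q * (q ^ 2) ^ S (3 * N + 2 * k) = q ^ 3 * (M * a ^ 4))
    by (unfold M, a; cpow_eq).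
  assert (E3 : q * (q ^ 2) ^ S (S (3 * N + 2 * k)) = q ^ 5 * (M * a ^ 4))
    by (unfold M, a; cpow_eq).
  assert (E4 : q * (q ^ 2) ^ k = q * a ^ 2) by (unfold a; cpow_eq).
  assert (E5 : q ^ 2 * (q ^ 2) ^ (2 * k) = q ^ 2 * a ^ 4) by (unfold a; cpow_eq).
  assert (E6 : q ^ 2 * (q ^ 2) ^ S (2 * k) = q ^ 4 * a ^ 4) by (unfold a; cpow_eq).
  assert (E7 : q ^ 3 * (q ^ 6) ^ N = q ^ 3 * M) by (unfold M; cpow_eq).
  assert (E8 : q ^ 6 * (q ^ 6) ^ (N + k) = q ^ 6 * (M * a ^ 6)) by (unfold M, a; cpow_eq).
  assert (E9 : q ^ (8 * k + 1 + 6 * N) = q * (M * a ^ 8)) by (unfold M, a; cpow_eq).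
  assert (E10 : q ^ (8 * k + 1 + 6 * S N) = q ^ 7 * (M * a ^ 8)) by (unfold M, a; cpow_eq).
  assert (E11 : q ^ (S (S (2 * k)) * S k) = q ^ (2 * k * k) * (a ^ 4 * q ^ 2))
    by (unfold a; cpow_eq).
  assert (E12 : q ^ (6 * N + 1) = q * M) by (unfold M; cpow_eq).
  assert (E13 : q ^ (4 * k) = a ^ 4) by (unfold a; cpow_eq).
  assert (E14 : q ^ (4 * S k) = q ^ 4 * a ^ 4) by (unfold a; cpow_eq).
  rewrite E1, E2, E3, E4, E5, E6, E7, E8, E9, E10, E11, E12, E13, E14.
  assert (N1 : 1 - q * a ^ 2 <> 0).
  { rewrite <- E4. replace (q * (q ^ 2) ^ k) with (q ^ S (2 * k)) by cpow_eq.
    now apply one_minus_pow_neq_0. }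
  assert (N2 : 1 - q ^ 2 * a ^ 4 <> 0).
  { rewrite <- E5. now apply (one_minus_pow_neq_0 (q ^ 2)). }
  assert (N3 : 1 - q ^ 4 * a ^ 4 <> 0).
  { rewrite <- E6. now apply (one_minus_pow_neq_0 (q ^ 2) (S (2 * k))). }
  assert (N4 : 1 - q ^ 3 * M <> 0).
  { rewrite <- E7. replace (q ^ 3 * (q ^ 6) ^ N) with (q ^ S (2 + 6 * N)) by cpow_eq.
    now apply one_minus_pow_neq_0. }
  assert (N5 : 1 - q ^ 6 * (M * a ^ 6) <> 0).
  { rewrite <- E8. now apply (one_minus_pow_neq_0 (q ^ 6)). }
  pose proof (qpoch_neq_0 (q ^ 2) (q ^ 2) (2 * k) Hp2 Hp2) as N6.
  pose proof (qpoch_neq_0 (q ^ 6) (q ^ 6) (N + k) Hp6 Hp6) as N7.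
  pose proof (qpoch_neq_0 (q ^ 3) (q ^ 6) N Hp3 Hp6) as N8.
  clear E1 E2 E3 E4 E5 E6 E7 E8 E9 E10 E11 E12 E13 E14.
  generalize dependent (qpoch (q ^ 2) (q ^ 2) (2 * k)).
  generalize dependent (qpoch (q ^ 6) (q ^ 6) (N + k)).
  generalize dependent (qpoch (q ^ 3) (q ^ 6) N).
  generalize (qpoch q (q ^ 2) (3 * N + 2 * k)) (qpoch q (q ^ 2) k)
    (lambert (q ^ 6) (q ^ 6) (N + k)) (lambert q (q ^ 2) k) (q ^ (2 * k * k)).
  clearbody a M. intros. cfield.
Qed.

(** * Uniform bounds, invariance and limit of the WZ family *)

Lemma Cmod_inv_le (z : C) (d : R) : (0 < d)%R -> (d <= Cmod z)%R -> (Cmod (/ z) <= / d)%R.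
Proof.
  intros Hd H. rewrite Cmod_inv by (apply Cmod_gt_0; lra).
  apply Rinv_le_contravar; auto.
Qed.

Lemma Cmod_mult_le (x y : C) (a b : R) :
  (Cmod x <= a)%R -> (Cmod y <= b)%R -> (Cmod (x * y) <= a * b)%R.
Proof.
  intros. rewrite Cmod_mult. apply Rmult_le_compat; auto using Cmod_ge_0.
Qed.

Lemma Cmod_minus_le (x y : C) (a b : R) :
  (Cmod x <= a)%R -> (Cmod y <= b)%R -> (Cmod (x - y) <= a + b)%R.
Proof.
  intros. unfold Cminus. eapply Rle_trans; [apply Cmod_triangle|].
  rewrite Cmod_opp. lra.
Qed.

Lemma cubic_kernel_bound (q : C) :
  (Cmod q < 1)%R -> exists K, forall m N k, (Cmod (cubic_kernel q m N k) <= K)%R.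
Proof.
  intros Hq.
  assert (Hr : (0 <= Cmod q < 1)%R) by (split; [apply Cmod_ge_0 | exact Hq]).
  destruct (qpoch_bounds _ Hr) as [d [Hd Hb]].
  destruct (lambert_bound _ Hr) as [M [HM Hl]].
  assert (Hle : forall n, (0 < n)%nat -> (Cmod (q ^ n) <= Cmod q)%R).
  { intros n Hn. now apply Cmod_pow_le. }
  (* The constant is assembled by unification from the bounds of the single factors, which depend on
     [Cmod q] alone. *)
  eexists. intros m N k. unfold cubic_kernel.
  repeat apply Cmod_mult_le; try apply Cmod_minus_le;
    try (apply (Cmod_inv_le _ d); [lra|]);
    first [apply Hb | apply Hl]; first [apply Rle_refl | apply Hle; lia].
Qed.

Lemma q_square_pow_le (q : C) (k : nat) :
  (Cmod q < 1)%R -> (Cmod (q ^ (2 * k * k)) <= Cmod q ^ k)%R.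
Proof.
  intros Hq. rewrite Cmod_pow. apply pow_le_compat_exp; [|nia].
  split; [apply Cmod_ge_0 | lra].
Qed.

Lemma Cmod_pow_le_1 (q : C) (n : nat) : (Cmod q < 1)%R -> (Cmod (q ^ n) <= 1)%R.
Proof.
  intros Hq. rewrite Cmod_pow, <- (pow1 n). apply pow_incr.
  split; [apply Cmod_ge_0 | lra].
Qed.

Lemma cubic_term_bound (q : C) :
  (Cmod q < 1)%R ->
  exists K, forall N k, (Cmod (cubic_term q N k) <= K * Cmod q ^ k)%R.
Proof.
  intros Hq. destruct (cubic_kernel_bound q Hq) as [K HK].
  exists ((1 + 1) * K)%R. intros N k. unfold cubic_term.
  replace ((1 + 1) * K * Cmod q ^ k)%R with (Cmod q ^ k * (1 + 1) * K)%R by ring.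
  apply Cmod_mult_le; auto. apply Cmod_mult_le; [now apply q_square_pow_le|].
  apply Cmod_minus_le; [rewrite Cmod_1; lra | now apply Cmod_pow_le_1].
Qed.

Lemma cubic_cert_lim (q : C) (N : nat) :
  (Cmod q < 1)%R -> clim (cubic_cert q N) 0.
Proof.
  intros Hq. destruct (cubic_kernel_bound q Hq) as [K HK].
  apply (clim_squeeze _ _ (fun k => (1 * (1 + 1) * (1 + 1) * K) * Cmod q ^ k)%R).
  - intros k. replace (cubic_cert q N k - 0) with (cubic_cert q N k) by ring.
    replace (1 * (1 + 1) * (1 + 1) * K * Cmod q ^ k)%R
      with (Cmod q ^ k * (1 * (1 + 1) * (1 + 1)) * K)%R by ring.
    apply Cmod_mult_le; auto. apply Cmod_mult_le; [now apply q_square_pow_le|].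
    repeat apply Cmod_mult_le; try apply Cmod_minus_le;
      try (now apply Cmod_pow_le_1); rewrite Cmod_1; lra.
  - apply geom_lim0. split; [apply Cmod_ge_0 | exact Hq].
Qed.

(** Summing the WZ equation over [k] leaves the certificate at both ends: zero at [k = 0] through
    the factor [1 - q^(4k)], and tending to zero through [q^(2k^2)]. *)
Lemma cubic_sum_invariant (q F : C) (N : nat) :
  (Cmod q < 1)%R ->
  clim (csum (cubic_term q 0)) F -> clim (csum (cubic_term q N)) F.
Proof.
  intros Hq HF. induction N as [|N IH]; auto.
  apply (clim_ext (fun n => csum (cubic_term q N) n + (- (1)) * cubic_cert q N n)).
  - intros n.
    rewrite (csum_ext (cubic_term q N) (fun k => cubic_term q (S N) k
       + (cubic_cert q N (S k) - cubic_cert q N k)))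
      by (intros; rewrite <- cubic_telescope by auto; ring).
    rewrite csum_plus, csum_telescope.
    assert (E : cubic_cert q N 0 = 0).
    { unfold cubic_cert. simpl (q ^ (4 * 0)). ring. }
    rewrite E. ring.
  - replace F with (F + (- (1)) * 0) by ring.
    apply clim_plus; auto. apply clim_scal. now apply cubic_cert_lim.
Qed.

(** The limiting summand contains [L6 - lambert q (q^2) k]; splitting this difference produces the
    triple products of weights [w_one] and [w_sq], which Bailey's lemma treats separately. *)
Lemma cubic_term_lim (q X P2 P4 L6 : C) (k : nat) :
  (0 < Cmod q)%R -> (Cmod q < 1)%R ->
  clim (qpoch q (q ^ 2)) X ->
  clim (qpoch (q ^ 3) (q ^ 6)) P2 -> P2 <> 0 ->
  clim (qpoch (q ^ 6) (q ^ 6)) P4 -> P4 <> 0 ->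
  clim (lambert (q ^ 6) (q ^ 6)) L6 ->
  clim (fun N => cubic_term q N k)
    (X / (P2 * (P4 * P4)) * (L6 * (q ^ (2 * k * k) * jtp_sum q w_one k)
                             + q ^ (2 * k * k) * jtp_sum q w_sq k)).
Proof.
  intros Hq0 Hq HX HP2 N2 HP4 N4 HL6.
  assert (Hr : (0 <= Cmod q < 1)%R) by (split; [apply Cmod_ge_0 | exact Hq]).
  destruct (qpoch_bounds _ Hr) as [d [Hd Hb]].
  assert (Hle : forall n, (0 < n)%nat -> (Cmod (q ^ n) <= Cmod q)%R).
  { intros n Hn. now apply Cmod_pow_le. }
  rewrite jtp_sum_one, jtp_sum_sq by auto.
  replace (X / (P2 * (P4 * P4)) * _) with
    (q ^ (2 * k * k) * (1 - 0)
     * (X * (qpoch q (q ^ 2) k * qpoch q (q ^ 2) k * / qpoch (q ^ 2) (q ^ 2) (2 * k))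
        * / P2 * (/ P4 * / P4) * (L6 - lambert q (q ^ 2) k))).
  2:{ assert (Hp2 : (Cmod (q ^ 2) < 1)%R) by (apply Cmod_pow_lt_1; auto; lia).
      pose proof (qpoch_neq_0 (q ^ 2) (q ^ 2) (2 * k) Hp2 Hp2) as N6. cfield. }
  unfold cubic_term, cubic_kernel.
  assert (H6 : clim (fun N => / qpoch (q ^ 6) (q ^ 6) (N + k)) (/ P4)).
  { apply (clim_inv _ _ d); auto; [lra | intros n; apply Hb; apply Hle; lia|].
    apply (clim_subseq (qpoch (q ^ 6) (q ^ 6)) P4 (fun N => (N + k)%nat)); auto.
    intros; lia. }
  apply clim_mult; [apply clim_scal|]; [|apply clim_mult; [apply clim_mult; [apply clim_mult;
    [apply clim_mult|]|]|]].
  - apply (clim_squeeze _ _ (fun N => 1 * Cmod q ^ N)%R); [|now apply geom_lim0].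
    intros N. replace (1 - q ^ (8 * k + 1 + 6 * N) - (1 - 0))
      with (- q ^ (8 * k + 1 + 6 * N)) by ring.
    rewrite Cmod_opp, Cmod_pow, Rmult_1_l. apply pow_le_compat_exp; [lra | lia].
  - apply (clim_subseq (qpoch q (q ^ 2)) X (fun N => (3 * N + 2 * k)%nat)); auto.
    intros; lia.
  - apply clim_const.
  - apply (clim_inv _ _ d); auto; [lra | intros n; apply Hb; apply Hle; lia].
  - now apply clim_mult.
  - apply clim_plus; [|apply clim_const].
    apply (clim_subseq (lambert (q ^ 6) (q ^ 6)) L6 (fun N => (N + k)%nat)); auto.
    intros; lia.
Qed.

Lemma w_one_bound (r : nat) : (Cmod (w_one r) <= INR (r * r) + 2)%R.
Proof.
  pose proof (pos_INR (r * r)).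
  destruct r; unfold w_one; rewrite Cmod_R, Rabs_pos_eq; lra.
Qed.

Lemma w_sq_bound (r : nat) : (Cmod (w_sq r) <= INR (r * r) + 2)%R.
Proof.
  unfold w_sq. rewrite Cmod_pow, Cmod_R, Rabs_pos_eq, mult_INR by apply pos_INR.
  simpl. lra.
Qed.

Lemma jtp_sum_bounds (q : C) :
  (0 < Cmod q)%R -> (Cmod q < 1)%R ->
  exists K, forall k,
    (Cmod (jtp_sum q w_one k) <= K)%R /\ (Cmod (jtp_sum q w_sq k) <= K)%R.
Proof.
  intros Hq0 Hq.
  assert (Hr : (0 <= Cmod q < 1)%R) by (split; [apply Cmod_ge_0 | exact Hq]).
  destruct (qpoch_bounds _ Hr) as [d [Hd Hb]].
  destruct (lambert_bound _ Hr) as [M [HM Hl]].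
  assert (H2 : (Cmod (q ^ 2) <= Cmod q)%R) by (apply Cmod_pow_le; auto).
  assert (H1 : forall k, (Cmod (jtp_sum q w_one k) <= (/ d) ^ 2 * / d)%R).
  { intros k. rewrite jtp_sum_one by auto. apply Cmod_mult_le.
    - rewrite Cmod_pow. apply pow_incr. split; [apply Cmod_ge_0|].
      apply Hb; auto. lra.
    - apply Cmod_inv_le; [lra|]. now apply Hb. }
  set (K := ((/ d) ^ 2 * / d)%R) in *.
  assert (HK : (0 <= K)%R) by (eapply Rle_trans; [apply Cmod_ge_0 | apply (H1 O)]).
  exists (K + K * M)%R. intros k. split.
  - specialize (H1 k). nra.
  - rewrite jtp_sum_sq by auto. rewrite <- jtp_sum_one by auto. rewrite Cmod_opp.
    apply Rle_trans with (K * M)%R; [|lra].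
    apply Cmod_mult_le; auto. apply Hl; auto. lra.
Qed.

(** * The two series of the theorem in terms of Lambert sums *)

(** Terms of odd index in the theorem's [j] carry exponents [6i - 3], those of even index [6i], with
    opposite signs; taking [2 * n] terms keeps the pairs together. *)
Lemma lambert_alternating (q : C) (n : nat) :
  (Cmod q < 1)%R ->
  csum (fun j => rhs_term q (S j)) (2 * n)
  = (1 - q) ^ 2 * (lambert (q ^ 3) (q ^ 6) n - lambert (q ^ 6) (q ^ 6) n).
Proof.
  intros Hq.
  assert (N1 : 1 - q <> 0) by now apply one_minus_neq_0.
  induction n as [|n IH].
  - unfold lambert. simpl. ring.
  - replace (2 * S n)%nat with (S (S (2 * n))) by lia.
    rewrite !lambert_S. cbn [csum]. rewrite IH. unfold rhs_term, qint.
    replace (S (2 * n) - 1)%nat with (2 * n)%nat by lia.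
    replace (S (S (2 * n)) - 1)%nat with (S (2 * n)) by lia.
    rewrite (Cpow_S (- 1)), (Cpow_mult_r (- 1) 2).
    replace ((- 1) ^ 2) with (RtoC 1) by (rewrite <- RtoC_pow; f_equal; ring).
    rewrite Cpow_1_l.
    pose proof (one_minus_pow_neq_0 q (2 + 6 * n) Hq) as N2.
    pose proof (one_minus_pow_neq_0 q (5 + 6 * n) Hq) as N3.
    assert (E1 : q ^ S (2 + 6 * n) = q ^ 3 * (q ^ 6) ^ n) by cpow_eq.
    assert (E2 : q ^ S (5 + 6 * n) = q ^ 6 * (q ^ 6) ^ n) by cpow_eq.
    rewrite E1 in N2. rewrite E2 in N3.
    assert (E3 : q ^ (3 * S (2 * n)) = q ^ 3 * (q ^ 6) ^ n) by cpow_eq.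
    assert (E4 : q ^ (3 * S (S (2 * n))) = q ^ 6 * (q ^ 6) ^ n) by cpow_eq.
    rewrite E3, E4. generalize dependent ((q ^ 6) ^ n). intros. cfield.
Qed.

(** A geometric majorant makes all partial sums converge; the limit is then read along the even
    ones, where [lambert_alternating] applies. *)
Lemma rhs_series (q L3 L6 : C) :
  (Cmod q < 1)%R ->
  clim (lambert (q ^ 3) (q ^ 6)) L3 -> clim (lambert (q ^ 6) (q ^ 6)) L6 ->
  clim (csum (fun j => rhs_term q (S j))) ((1 - q) ^ 2 * (L3 - L6)).
Proof.
  intros Hq H3 H6.
  assert (Hr : (0 <= Cmod q < 1)%R) by (split; [apply Cmod_ge_0 | exact Hq]).
  assert (N1 : 1 - q <> 0) by now apply one_minus_neq_0.
  destruct (csum_geom_cvg (fun j => rhs_term q (S j))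
    (Cmod ((1 - q) ^ 2) * / (1 - Cmod q) ^ 2) (Cmod q) Hr) as [T HT].
  - intros j. unfold rhs_term, qint.
    pose proof (one_minus_pow_neq_0 q (2 + 3 * j) Hq) as N2.
    assert (E1 : q ^ S (2 + 3 * j) = q ^ 3 * (q ^ 3) ^ j) by cpow_eq.
    rewrite E1 in N2.
    assert (E2 : q ^ (3 * S j) = q ^ 3 * (q ^ 3) ^ j) by cpow_eq. rewrite E2.
    replace ((- 1) ^ (S j - 1) * (q ^ 3 * (q ^ 3) ^ j) / _)
      with ((- 1) ^ (S j - 1) * ((1 - q) ^ 2
         * (q ^ 3 * (q ^ 3) ^ j / (1 - q ^ 3 * (q ^ 3) ^ j) ^ 2))).
    2:{ generalize ((- 1) ^ (S j - 1)). generalize dependent ((q ^ 3) ^ j).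
        intros. cfield. }
    rewrite Cmod_mult, Cmod_pow, Cmod_R, Rabs_m1, pow1, Rmult_1_l, Cmod_mult, Rmult_assoc.
    apply Rmult_le_compat_l; [apply Cmod_ge_0|].
    apply lambert_term_le; auto; apply Cmod_pow_le; auto; lia.
  - replace ((1 - q) ^ 2 * (L3 - L6)) with T; auto.
    apply (clim_unique (fun n => csum (fun j => rhs_term q (S j)) (2 * n))).
    + apply (clim_subseq (csum (fun j => rhs_term q (S j))) T (fun n => (2 * n)%nat)); auto.
      intros; lia.
    + apply (clim_ext (fun n => (1 - q) ^ 2
         * (lambert (q ^ 3) (q ^ 6) n + (- (1)) * lambert (q ^ 6) (q ^ 6) n))).
      * intros n. rewrite lambert_alternating by auto. ring.
      * replace (L3 - L6) with (L3 + (- (1)) * L6) by ring.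
        apply clim_scal, clim_plus; auto. now apply clim_scal.
Qed.

(** The inner sum is [(1 - q)^2] times a difference of Lambert sums, opposite in sign to that of the
    kernel; the denominator of [qint q (8 * k + 1)] uses up one factor [1 - q]. *)
Lemma lhs_term_cubic (q : C) (k : nat) :
  (Cmod q < 1)%R -> lhs_term q k = - (1 - q) * cubic_term q 0 k.
Proof.
  intros Hq.
  assert (N1 : 1 - q <> 0) by now apply one_minus_neq_0.
  assert (Hp2 : (Cmod (q ^ 2) < 1)%R) by (apply Cmod_pow_lt_1; auto; lia).
  assert (Hp6 : (Cmod (q ^ 6) < 1)%R) by (apply Cmod_pow_lt_1; auto; lia).
  assert (E : sum1 (fun i => q ^ (2 * i - 1) / (qint q (2 * i - 1) * qint q (2 * i - 1))
                 - q ^ (6 * i) / (qint q (6 * i) * qint q (6 * i))) k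
    = (1 - q) ^ 2 * (lambert q (q ^ 2) k - lambert (q ^ 6) (q ^ 6) k)).
  { induction k as [|k IH]; [unfold lambert; simpl; ring|].
    cbn [sum1]. rewrite IH, !lambert_S. unfold qint.
    replace (2 * S k - 1)%nat with (S (2 * k)) by lia.
    pose proof (one_minus_pow_neq_0 q (2 * k) Hq) as N2.
    pose proof (one_minus_pow_neq_0 (q ^ 6) k Hp6) as N3.
    replace (q ^ (6 * S k)) with (q ^ 6 * (q ^ 6) ^ k) by cpow_eq.
    assert (E1 : q ^ S (2 * k) = q * (q ^ 2) ^ k) by cpow_eq.
    rewrite E1 in *. rewrite Cpow_S in N3.
    generalize dependent ((q ^ 6) ^ k). generalize dependent ((q ^ 2) ^ k).
    intros. cfield. }
  unfold lhs_term. rewrite E. unfold cubic_term, cubic_kernel, qint.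
  pose proof (qpoch_neq_0 (q ^ 2) (q ^ 2) (2 * k) Hp2 Hp2) as N6.
  pose proof (qpoch_neq_0 (q ^ 6) (q ^ 6) k Hp6 Hp6) as N7.
  replace (8 * k + 1 + 6 * 0)%nat with (8 * k + 1)%nat by lia.
  change (3 * 0 + 2 * k)%nat with (2 * k)%nat. change (0 + k)%nat with k.
  cbn [qpoch]. cfield.
Qed.

Lemma qpoch_shift (x b : C) (n : nat) :
  qpoch x b (S n) = (1 - x) * qpoch (x * b) b n.
Proof.
  induction n as [|n IH]; [simpl; ring|].
  rewrite qpoch_S, IH, qpoch_S, Cpow_S. ring.
Qed.

Theorem theorem1p5 (q : C) (hq0 : 0 < Cmod q) (hq1 : Cmod q < 1) :
  exists (S T P1 P2 P3 P4 : C),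
    is_series (fun k => lhs_term q (Datatypes.S k)) S /\
    is_series (fun j => rhs_term q (Datatypes.S j)) T /\
    qpoch_inf_is (q ^ 3) (q ^ 2) P1 /\
    qpoch_inf_is (q ^ 3) (q ^ 6) P2 /\
    qpoch_inf_is (q ^ 2) (q ^ 2) P3 /\
    qpoch_inf_is (q ^ 6) (q ^ 6) P4 /\
    S = P1 * P2 / (P3 * P4) * T.
Proof.
  assert (Hr : (0 <= Cmod q < 1)%R) by (split; [apply Cmod_ge_0 | exact hq1]).
  assert (N1 : 1 - q <> 0) by now apply one_minus_neq_0.
  assert (Hp2 : (Cmod (q ^ 2) < 1)%R) by (apply Cmod_pow_lt_1; auto; lia).
  assert (Hp3 : (Cmod (q ^ 3) < 1)%R) by (apply Cmod_pow_lt_1; auto; lia).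
  assert (Hp6 : (Cmod (q ^ 6) < 1)%R) by (apply Cmod_pow_lt_1; auto; lia).
  assert (Hp30 : (0 < Cmod (q ^ 3))%R) by (rewrite Cmod_pow; now apply pow_lt).
  destruct (qpoch_inf_ex (q ^ 3) (q ^ 2)) as [P1 [_ HP1]]; auto.
  destruct (qpoch_inf_ex (q ^ 3) (q ^ 6)) as [P2 [NP2 HP2]]; auto.
  destruct (qpoch_inf_ex (q ^ 2) (q ^ 2)) as [P3 [NP3 HP3]]; auto.
  destruct (qpoch_inf_ex (q ^ 6) (q ^ 6)) as [P4 [NP4 HP4]]; auto.
  destruct (lambert_cvg (q ^ 3) (q ^ 6)) as [L3 HL3]; auto.
  destruct (lambert_cvg (q ^ 6) (q ^ 6)) as [L6 HL6]; auto.
  (* The WZ limit involves [(q;q^2)_oo], which is [(1 - q) (q^3;q^2)_oo]. *)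
  assert (HX : clim (qpoch q (q ^ 2)) ((1 - q) * P1)).
  { apply (is_lim_seq_incr_1 (fun n => Cmod (qpoch q (q ^ 2) n - (1 - q) * P1))).
    apply (clim_ext (fun n => (1 - q) * qpoch (q ^ 3) (q ^ 2) n)).
    - intros n. rewrite qpoch_shift. now rewrite <- (Cpow_S q 2).
    - now apply clim_scal. }
  destruct (jtp_sum_bounds q hq0 hq1) as [K HK].
  destruct (jtp_series q P3 P4 w_one K) as [L1 [HL1 HS1]]; auto using w_one_bound.
  { intros k. apply HK. }
  destruct (jtp_series q P3 P4 w_sq K) as [L2 [HL2 HS2]]; auto using w_sq_bound.
  { intros k. apply HK. }
  assert (E36 : (q ^ 3) ^ 2 = q ^ 6) by cpow_eq.
  destruct (qpoch_bounds _ Hr) as [d [Hd Hb]].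
  assert (Hq : clim (fun n => qpoch (q ^ 3) (q ^ 6) n ^ 2 / qpoch (q ^ 6) (q ^ 6) (2 * n))
                 (P2 * P2 * / P4)).
  { apply clim_mult.
    - apply (clim_ext (fun n => qpoch (q ^ 3) (q ^ 6) n * qpoch (q ^ 3) (q ^ 6) n)).
      + intros n. ring.
      + now apply clim_mult.
    - apply (clim_inv _ _ d); auto; [lra | intros n; apply Hb; apply Cmod_pow_le; auto; lia|].
      apply (clim_subseq (qpoch (q ^ 6) (q ^ 6)) P4 (fun n => (2 * n)%nat)); auto.
      intros; lia. }
  (* [jtp_series] gives [L1] and [L2] only as limits; the closed forms of the triple product at
     [q^3] identify them. *)
  assert (EL1 : L1 = P2 * P2 * / P4).
  { apply (clim_unique (jtp_sum (q ^ 3) w_one)); auto.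
    revert Hq. apply clim_ext. intros n. now rewrite jtp_sum_one, E36 by auto. }
  assert (EL2 : L2 = (- (1)) * (P2 * P2 * / P4 * L3)).
  { apply (clim_unique (jtp_sum (q ^ 3) w_sq)); auto.
    apply (clim_ext (fun n => (- (1)) * (qpoch (q ^ 3) (q ^ 6) n ^ 2
       / qpoch (q ^ 6) (q ^ 6) (2 * n) * lambert (q ^ 3) (q ^ 6) n))).
    - intros n. rewrite jtp_sum_sq, E36 by auto. ring.
    - now apply clim_scal, clim_mult. }
  destruct (cubic_term_bound q hq1) as [Kc HKc].
  destruct (csum_geom_cvg (cubic_term q 0) Kc (Cmod q) Hr (HKc O)) as [F HF].
  assert (EF : F = (1 - q) * P1 / (P2 * (P4 * P4))
     * (L6 * (L1 * (P4 * P4) / P3) + L2 * (P4 * P4) / P3)).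
  (* The sum over [k] is [F] for every [N], so [F] is also the sum of the termwise limits as [N]
     grows. *)
  { apply (clim_unique (fun _ => F)); [apply clim_const|].
    apply (tannery (cubic_term q) (fun k => (1 - q) * P1 / (P2 * (P4 * P4))
       * (L6 * (q ^ (2 * k * k) * jtp_sum q w_one k)
          + q ^ (2 * k * k) * jtp_sum q w_sq k)) _ _ Kc (Cmod q)); auto.
    - intros k. now apply cubic_term_lim.
    - intros N. now apply cubic_sum_invariant.
    - apply (clim_ext (fun n => (1 - q) * P1 / (P2 * (P4 * P4))
       * (L6 * csum (fun k => q ^ (2 * k * k) * jtp_sum q w_one k) n
          + csum (fun k => q ^ (2 * k * k) * jtp_sum q w_sq k) n))).
      + intros n. now rewrite <- csum_scal, <- csum_plus, <- csum_scal.
      + apply clim_scal, clim_plus; auto. now apply clim_scal. }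
  exists (- (1 - q) * F), ((1 - q) ^ 2 * (L3 - L6)), P1, P2, P3, P4.
  split; [|split; [|split; [|split; [|split; [|split]]]]];
    try (now apply clim_filterlim).
  - apply is_series_clim.
    apply (clim_ext (fun n => - (1 - q) * csum (cubic_term q 0) (S n))).
    + intros n. rewrite csum_head.
      rewrite (csum_ext (fun k => lhs_term q (S k)) (fun k => - (1 - q) * cubic_term q 0 (S k)))
        by (intros; now apply lhs_term_cubic).
      rewrite csum_scal.
      (* Both Lambert sums are empty at [N = k = 0], so this term can be prepended to a series that
         starts at [k = 1]. *)
      assert (E0 : cubic_term q 0 0 = 0).
      { unfold cubic_term, cubic_kernel, lambert. simpl. ring. }
      rewrite E0. ring.
    + apply clim_scal. apply (clim_subseq (csum (cubic_term q 0)) F S); auto.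
  - apply is_series_clim. now apply rhs_series.
  (* Here [F] collapses to [(1 - q) P1 P2 (L6 - L3) / (P3 P4)]. *)
  - rewrite EF, EL1, EL2. cfield.
Qed.
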